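(* For any $\lambda,\eta\in(0,1)$ and any $0<\beta<\alpha<1$ there exists a single reservoir distribution $\mu$ satisfying $G_\mu^{-1}(1-\eta)=\alpha$ such that for any sequence $(\mathcal{A}_N)_{N\ge1}$ where each $\mathcal{A}_N$ is an $N$-sample algorithm (possibly depending on $\mu$), letting $a_{i^*}$ be the output of $\mathcal{A}_N$ run on reservoir $\mu$, \[ \liminf_{N\to\infty}\frac{\big(-\log\mathbb{P}[p_{i^*}<\beta]\big)\cdot\log^2N}{N}\ \le\ c_{\alpha,\beta}+\lambda, \qquad c_{\alpha,\beta}=\frac{\big(\arccos(1-2\alpha)-\arccos(1-2\beta)\big)^2}{2}. \]
   Context: Infinite-armed Bernoulli bandit: a reservoir distribution $\mu$ is any Borel probability measure on $[0,1]$. There are countably many arms $a_1,a_2,\dots$ whose means $p_1,p_2,\dots$ are drawn i.i.d. from $\mu$. Each time arm $a_i$ is sampled it returns a reward in $\{0,1\}$ distributed as Bernoulli$(p_i)$, independently of all other rewards given the means. An algorithm, at each step, chooses (based on previously observed rewards and possibly internal randomness) an arm to sample, and at the end outputs an arm index $i^*$. An $N$-sample algorithm is one that takes exactly $N$ samples almost surely and then outputs $i^*$. Probabilities are over the means, rewards and algorithm randomness. $G_\mu(\tau)=\mu([0,\tau])$ and $G_\mu^{-1}(p)=\inf\{\tau:G_\mu(\tau)\ge p\}$. *)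

(* Defs.v *)
From HB Require Import structures.
From mathcomp Require Import all_boot all_order all_algebra.
From mathcomp Require Import all_classical all_reals all_analysis.
Set Implicit Arguments. Unset Strict Implicit. Unset Printing Implicit Defensive.
Import Order.TTheory GRing.Theory Num.Theory.
Local Open Scope classical_set_scope.
Local Open Scope ring_scope.

Section Bandit.
Variable R : realType.

Definition is_reservoir (mu : probability R R) : Prop :=
  mu [set` `[0%R, 1%R]] = 1%E.

Definition G (mu : probability R R) (tau : R) : \bar R := mu [set` `[0%R, tau]].

Definition Ginv (mu : probability R R) (p : R) : R :=
  inf [set tau : R | (p%:E <= G mu tau)%E].

(* A deterministic strategy: given the reward history (the arms pulled are
   determined by it), choose the index of the next arm; and the output arm
   index as a function of the full reward history. *)
Record detAlg := DetAlg { choose : seq bool -> nat ; output : seq bool -> nat }.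
HB.instance Definition _ := gen_eqMixin detAlg.
HB.instance Definition _ := gen_choiceMixin detAlg.

Definition bern (q : R) (b : bool) : R := if b then q else 1 - q.

Definition err_given_means (d : detAlg) (beta : R) (N : nat) (p : nat -> R) : R :=
  \sum_(r : N.-tuple bool)
     (\prod_(t < N) bern (p (choose d (take t r))) (tnth r t))
       * (if p (output d r) < beta then 1 else 0).

Definition arm_bound (d : detAlg) (N : nat) : nat :=
  (\max_(r : N.-tuple bool)
      maxn (output d r) (\max_(t < N) choose d (take t r))).+1.

Definition scons (x : R) (p : nat -> R) : nat -> R :=
  fun n => if n is n'.+1 then p n' else x.

(* Integral of f over i.i.d. means p_0, ..., p_{M-1} ~ mu (the remaining
   coordinates are irrelevant for the integrands used below). *)
Fixpoint iint (mu : probability R R) (M : nat) (f : (nat -> R) -> \bar R)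
  : \bar R :=
  match M with
  | 0 => f (fun _ => 0)
  | M'.+1 => (\int[mu]_(x in setT) iint mu M' (fun p => f (scons x p)))%E
  end.

Definition det_err (mu : probability R R) (d : detAlg) (beta : R) (N : nat)
  : \bar R :=
  iint mu (arm_bound d N) (fun p => (err_given_means d beta N p)%:E).

(* A randomized algorithm (with arbitrary internal randomness) is a
   probability distribution on deterministic strategies; since for fixed N
   there are only countably many distinct N-sample strategies, it is given by
   nonnegative weights summing to 1. *)
Definition rand_alg (w : detAlg -> R) : Prop :=
  (forall d, 0 <= w d) /\ (\esum_(d in setT) (w d)%:E = 1)%E.

Definition rand_err (mu : probability R R) (w : detAlg -> R) (beta : R)
  (N : nat) : \bar R :=
  (\esum_(d in setT) ((w d)%:E * det_err mu d beta N))%E.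

Definition rate (P : \bar R) (N : nat) : \bar R :=
  if P == 0%E then +oo%E
  else ((- ln (fine P)) * (ln N%:R) ^+ 2 / N%:R)%:E.

Definition c_ab (alpha beta : R) : R :=
  (acos (1 - 2 * alpha) - acos (1 - 2 * beta)) ^+ 2 / 2.

End Bandit.

(* Main.v *)
Require Import Defs.
From HB Require Import structures.
From mathcomp Require Import all_boot all_order all_algebra.
From mathcomp Require Import all_classical all_reals all_analysis.
From mathcomp Require Import ring lra.
Set Implicit Arguments. Unset Strict Implicit. Unset Printing Implicit Defensive.
Import Order.TTheory GRing.Theory Num.Theory numFieldNormedType.Exports.
Local Open Scope classical_set_scope.
Local Open Scope ring_scope.
Local Notation choose := Defs.choose.

(**
In the angle [th], with mean [(1 - cos th) / 2], the Kullback-Leibler divergence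
between two Bernoulli laws is half the squared angular distance up to third
order. Take a countable reservoir whose atoms are dense between the angle of
[alpha] (with mass more than [eta]) and an angle [lo] slightly below that of
[beta]. Compare the true arms with fictitious ones whose angle drifts, as a
function of the logarithm of the number of pulls, from its initial value down to
[lo], at speed about [D / ln N], where [D] is the angular distance between
[alpha] and [beta]. When such an arm has been pulled [n] times, the average of
[(ln (n / i) - 1)^2] over [i <= n] is about 1, so the reservoir atom close to the
angle at time [n / e] explains the rewards at a cost of about
[n (D / ln N)^2 / 2]. Since this holds whatever the time [n] at which the
strategy abandons the arm, the total cost of [N] pulls is about
[N D^2 / (2 ln^2 N)]; and an output arm that has been pulled long enough is
explained by the atom at [lo], whose mean is less than [beta].

Formally the fictitious likelihood of one arm, restricted to reward sequences
along which the explanation is cheap at all times (all but a negligible part, by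
a Chernoff bound), gives a function [H] on histories of one arm that lies below
the true mixture likelihood and loses at most a factor [e] per pull; products of
such functions bound the error of any strategy from below.
*)

(** * Strategies and arm histories *)

Lemma sum_bool (V : nmodType) (f : bool -> V) :
  \sum_(b : bool) f b = f true + f false.
Proof. by rewrite /index_enum !unlock /= /reducebig /= addr0. Qed.

Lemma sum_tuple0 (T : finType) (V : nmodType) (f : seq T -> V) :
  \sum_(r : 0.-tuple T) f r = f [::].
Proof.
rewrite (bigD1 [tuple]) //= big1 ?addr0// => r /eqP; case.
by rewrite tuple0.
Qed.

Lemma sum_tuple_cons (T : finType) (V : nmodType) n (f : seq T -> V) :
  \sum_(r : n.+1.-tuple T) f r = \sum_(b : T) \sum_(r : n.-tuple T) f (b :: r).
Proof.
rewrite pair_big /=.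
rewrite (reindex (fun p : T * n.-tuple T => [tuple of p.1 :: p.2])) /=; last first.
  exists (fun r => (thead r, [tuple of behead r])) => [[b r] _|r _] /=.
    by rewrite theadE; congr pair; apply: val_inj.
  by rewrite [RHS]tuple_eta.
by apply: eq_bigr => -[b r] _.
Qed.

Lemma sum_tuple_rcons (T : finType) (V : nmodType) n (f : seq T -> V) :
  \sum_(r : n.+1.-tuple T) f r = \sum_(r : n.-tuple T) \sum_(b : T) f (rcons r b).
Proof.
elim: n f => [|n IH] f.
  rewrite sum_tuple_cons (sum_tuple0 (fun r => \sum_b f (rcons r b))).
  by apply: eq_bigr => b _; rewrite (sum_tuple0 (fun r => f (b :: r))).
rewrite sum_tuple_cons (sum_tuple_cons _ (fun r => \sum_b f (rcons r b))).
by apply: eq_bigr => b _; rewrite (IH (fun r => f (b :: r))).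
Qed.

Definition arm_history (d : detAlg) (a : nat) (r : seq bool) : seq bool :=
  [seq nth false r t | t <- iota 0 (size r) & choose d (take t r) == a].

Lemma arm_history_rcons d a r b : arm_history d a (rcons r b) =
  if choose d r == a then rcons (arm_history d a r) b else arm_history d a r.
Proof.
rewrite /arm_history size_rcons -addn1 iotaD add0n filter_cat map_cat /=.
rewrite -cats1 take_size_cat //.
have -> : [seq nth false (r ++ [:: b]) t | t <- iota 0 (size r) &
            choose d (take t (r ++ [:: b])) == a] = arm_history d a r.
  rewrite /arm_history.
  have -> : [seq t <- iota 0 (size r) | choose d (take t (r ++ [:: b])) == a] =
            [seq t <- iota 0 (size r) | choose d (take t r) == a].
    apply: eq_in_filter => t; rewrite mem_iota add0n => /andP[_ tr].
    by rewrite takel_cat // ltnW.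
  apply/eq_in_map => t; rewrite mem_filter mem_iota add0n => /andP[_ /andP[_ tr]].
  by rewrite nth_cat tr.
case: ifP => _ /=; last by rewrite cats0.
by rewrite nth_cat ltnn subnn cats1.
Qed.

Lemma size_arm_history d a r : (size (arm_history d a r) <= size r)%N.
Proof.
elim/last_ind: r => [//|r b IH]; rewrite arm_history_rcons size_rcons.
by case: ifP => _; rewrite ?size_rcons ?ltnS// (leq_trans IH).
Qed.

Section Strategies.
Variable R : realType.
Implicit Types (d : detAlg) (r u : seq bool) (H : seq bool -> R) (p : nat -> R).

Definition likelihood (x : R) u : R := \prod_(b <- u) bern x b.

Lemma likelihood_ge0 (x : R) u : 0 <= x <= 1 -> 0 <= likelihood x u.
Proof.
move=> /andP[x0 x1]; apply: prodr_ge0 => b _; rewrite /bern; case: b => //.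
by rewrite subr_ge0.
Qed.

Lemma likelihood_rcons (x : R) u b :
  likelihood x (rcons u b) = likelihood x u * bern x b.
Proof. by rewrite /likelihood -cats1 big_cat big_seq1. Qed.

(** Appending a reward changes the history of the sampled arm only, so the likelihood of a run
    regroups by arms whatever the strategy. *)
Lemma prod_bern_arms d (M : nat) p r :
  (forall t, (t < size r)%N -> (choose d (take t r) < M)%N) ->
  \prod_(t < size r) bern (p (choose d (take t r))) (nth false r t) =
  \prod_(a < M) likelihood (p a) (arm_history d a r).
Proof.
elim/last_ind: r => [|r b IH] Hr.
  by rewrite big_ord0 big1 // => a _; rewrite /likelihood big_nil.
have Hc : (choose d r < M)%N.
  by have := Hr (size r); rewrite size_rcons ltnS leqnn -cats1 take_size_cat // => /(_ isT).
rewrite size_rcons big_ord_recr /=.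
have -> : take (size r) (rcons r b) = r by rewrite -cats1 take_size_cat.
rewrite nth_rcons ltnn eqxx.
under eq_bigr => t _.
  rewrite -cats1 takel_cat; last by rewrite ltnW.
  rewrite nth_cat ltn_ord; over.
rewrite IH; last first.
  move=> t tr; have := Hr t; rewrite size_rcons ltnS (ltnW tr) => /(_ isT).
  by rewrite -cats1 takel_cat // ltnW.
rewrite (bigD1 (Ordinal Hc)) //= [RHS](bigD1 (Ordinal Hc)) //=.
rewrite arm_history_rcons eqxx likelihood_rcons mulrAC; congr (_ * _).
apply: eq_bigr => a.
rewrite -val_eqE /= => ac; rewrite arm_history_rcons ifF //.
by apply/negbTE; rewrite eq_sym.
Qed.

(* A sampling step multiplies the factor of the sampled arm only, so a lower
   bound on the one-step growth of [H] propagates to the whole run, whatever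
   the strategy. *)
Lemma sum_prod_arm_history_ge d (M N : nat) H (e : R) : 0 <= e <= 1 ->
  (forall u, 0 <= H u) ->
  (forall u, (size u < N)%N -> e * H u <= H (rcons u true) + H (rcons u false)) ->
  e ^+ N * H [::] ^+ M <=
  \sum_(r : N.-tuple bool) \prod_(a < M) H (arm_history d a r).
Proof.
move=> /andP[e0 e1] H0 He.
suff: forall n, (n <= N)%N -> e ^+ n * H [::] ^+ M <=
    \sum_(r : n.-tuple bool) \prod_(a < M) H (arm_history d a r) by exact.
elim=> [_|n IH nN].
  rewrite (sum_tuple0 (fun r => \prod_(a < M) H (arm_history d a r))).
  by rewrite expr0 mul1r /arm_history /= prodr_const card_ord.
rewrite (sum_tuple_rcons _ (fun r => \prod_(a < M) H (arm_history d a r))).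
rewrite exprS -mulrA; apply: le_trans (ler_wpM2l e0 (IH (ltnW nN))) _.
rewrite mulr_sumr; apply: ler_sum => r _; rewrite sum_bool.
have P0 : 0 <= \prod_(a < M) H (arm_history d a r) by apply: prodr_ge0.
(* Sampling an arm outside the first [M] leaves the product unchanged: the two outcomes give it
   twice, and [e <= 1] suffices. *)
have [cM|Mc] := ltnP (choose d r) M; last first.
  have E b : \prod_(a < M) H (arm_history d a (rcons r b)) =
             \prod_(a < M) H (arm_history d a r).
    apply: eq_bigr => a _; rewrite arm_history_rcons ifF //.
    by apply/negbTE; rewrite neq_ltn (leq_trans (ltn_ord a) Mc) orbT.
  rewrite !E; apply: le_trans (ler_wpM2r P0 e1) _.
  by rewrite mul1r lerDl.
have E b : \prod_(a < M) H (arm_history d a (rcons r b)) =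
    H (rcons (arm_history d (choose d r) r) b) *
    \prod_(a < M | a != Ordinal cM) H (arm_history d a r).
  rewrite (bigD1 (Ordinal cM)) //= arm_history_rcons eqxx; congr (_ * _).
  apply: eq_bigr => a; rewrite -val_eqE /= => ac; rewrite arm_history_rcons ifF //.
  by apply/negbTE; rewrite eq_sym.
rewrite !E -mulrDl (bigD1 (Ordinal cM)) //= mulrA.
apply: ler_wpM2r; first by apply: prodr_ge0.
by apply: He; rewrite (leq_ltn_trans (size_arm_history _ _ _)) // size_tuple.
Qed.

End Strategies.

(** * Paths of drifting means *)

Section Path.
Variables (R : realType) (q : nat -> R).
Hypothesis q01 : forall i, 0 < q i < 1.
Implicit Types (u v : seq bool) (x : R).

Let bern_gt0 x b : 0 < x < 1 -> 0 < bern x b.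
Proof. by case/andP=> x0 x1; case: b; rewrite /bern ?subr_gt0. Qed.

Definition path_likelihood u : R := \prod_(i < size u) bern (q i) (nth false u i).
Local Notation G := path_likelihood.

Lemma path_likelihood_rcons u b : G (rcons u b) = G u * bern (q (size u)) b.
Proof.
rewrite /G size_rcons big_ord_recr /= nth_rcons ltnn eqxx; congr (_ * _).
by apply: eq_bigr => i _; rewrite nth_rcons ltn_ord.
Qed.

Lemma path_likelihood_gt0 u : 0 < G u.
Proof. by apply: prodr_gt0 => i _; apply: bern_gt0. Qed.

Lemma sum_bern x : bern x true + bern x false = 1.
Proof. by rewrite /bern; ring. Qed.

(** The rewards after time [n] sum out to 1, so path likelihoods are consistent in the horizon. *)
Lemma sum_path_likelihood_take N n (g : seq bool -> R) : (n <= N)%N ->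
  \sum_(v : N.-tuple bool) G v * g (take n v) =
  \sum_(u : n.-tuple bool) G u * g u.
Proof.
elim: N => [|N IH]; first by rewrite leqn0 => /eqP ->; apply: eq_bigr => v _; rewrite tuple0.
rewrite leq_eqVlt => /predU1P[->|nN].
  by apply: eq_bigr => v _; rewrite take_oversize // size_tuple.
rewrite -IH // (sum_tuple_rcons _ (fun v => G v * g (take n v))).
apply: eq_bigr => v _; rewrite sum_bool !path_likelihood_rcons.
rewrite -!cats1 !takel_cat ?size_tuple // -mulrDl -mulrDr sum_bern.
by rewrite mulr1.
Qed.

Lemma sum_path_likelihood N : \sum_(v : N.-tuple bool) G v = 1.
Proof.
have := @sum_path_likelihood_take N 0 (fun=> 1) (leq0n N).
under eq_bigr do rewrite mulr1.
by move=> ->; rewrite (sum_tuple0 (fun u => G u * 1)) /G /= big_ord0 mulr1.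
Qed.

Lemma path_likelihood_le1 u : G u <= 1.
Proof.
rewrite -(sum_path_likelihood (size u)) (bigD1 (in_tuple u)) //= lerDl.
by apply: sumr_ge0 => v _; apply/ltW/path_likelihood_gt0.
Qed.

(** This is [expR (s * D)], with [D] the Renyi divergence of order [1 + s] of the Bernoulli law of
    mean [a] from that of mean [x]. *)
Definition llr_mgf (s a x : R) : R :=
  \sum_(b : bool) bern a b * expR (s * ln (bern a b / bern x b)).

Lemma sum_path_llr s x n : 0 < x < 1 ->
  \sum_(u : n.-tuple bool) G u * expR (s * ln (G u / likelihood x u)) =
  \prod_(i < n) llr_mgf s (q i) x.
Proof.
move=> x01; elim: n => [|n IH].
  rewrite (sum_tuple0 (fun u => G u * expR (s * ln (G u / likelihood x u)))).
  by rewrite /G /likelihood /= !big_ord0 big_nil divr1 ln1 mulr0 expR0 mulr1.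
rewrite (sum_tuple_rcons _ (fun u => G u * expR (s * ln (G u / likelihood x u)))).
rewrite big_ord_recr /= -IH mulr_suml; apply: eq_bigr => u _.
rewrite /llr_mgf mulr_sumr; apply: eq_bigr => b _.
have L0 : 0 < likelihood x u by apply: prodr_gt0 => c _; apply: bern_gt0.
rewrite path_likelihood_rcons likelihood_rcons size_tuple.
have -> : G u * bern (q n) b / (likelihood x u * bern x b) =
          (G u / likelihood x u) * (bern (q n) b / bern x b).
  by rewrite invfM mulrACA.
rewrite lnM ?posrE ?divr_gt0 ?path_likelihood_gt0 ?bern_gt0 //.
by rewrite mulrDr expRD mulrACA.
Qed.

Variables (N : nat) (kappa : R) (late : pred nat) (w x : nat -> R).
Hypothesis w0 : forall n, 0 < w n.
Hypothesis x01 : forall n, 0 < x n < 1.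

(** The test says that an atom of mean [x n] and mass [w n] explains the [n] rewards [u] at a cost
    of at most [kappa] per pull. *)
Definition good_at n u : bool :=
  expR (- (kappa * n%:R)) * G u <= w n * likelihood (x n) u.

Definition good_path v : bool :=
  all (fun n => late n ==> good_at n (take n v)) (iota 0 N.+1).

(** Goodness is required of the whole sequence of length [N] extending [u], not of [u] alone; this
    makes the mass split exactly when one more reward is seen. *)
Definition good_mass u : R :=
  \sum_(v : N.-tuple bool | (take (size u) v == u) && good_path v) G v.

Lemma good_mass_ge0 u : 0 <= good_mass u.
Proof. by apply: sumr_ge0 => v _; apply/ltW/path_likelihood_gt0. Qed.

Lemma good_mass_split u : (size u < N)%N ->
  good_mass u = good_mass (rcons u true) + good_mass (rcons u false).
Proof.
move=> uN; rewrite /good_mass (bigID (fun v : N.-tuple bool => nth false v (size u))) /=.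
congr (_ + _); apply: eq_bigl => v; rewrite size_rcons (take_nth false) ?size_tuple //;
  rewrite eqseq_rcons; case: (nth _ _ _); case: (take _ _ == u) => //=; by case: good_path.
Qed.

Lemma good_mass_le u : (size u <= N)%N -> good_mass u <= G u.
Proof.
move=> uN; rewrite /good_mass.
apply: (@le_trans _ _ (\sum_(v : N.-tuple bool) G v * (take (size u) v == u)%:R)).
  rewrite big_mkcond /=; apply: ler_sum => v _; case: (take _ _ == u) => /=.
    by case: good_path; rewrite mulr1 // ltW // path_likelihood_gt0.
  by rewrite mulr0.
rewrite (@sum_path_likelihood_take N (size u) (fun t => (t == u)%:R)) //.
rewrite (bigD1 (in_tuple u)) //= eqxx mulr1 big1 ?addr0 // => v vu.
rewrite (_ : (_ == _) = false) ?mulr0 //.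
by apply/negbTE; apply: contra vu => /eqP vu; apply/eqP/val_inj.
Qed.

(** If [u] passes the test at its own length, the test bounds its path likelihood and hence the
    mass; otherwise no good sequence extends [u] and the mass is 0. *)
Lemma good_mass_late u : (size u <= N)%N -> late (size u) ->
  expR (- (kappa * (size u)%:R)) * good_mass u <= w (size u) * likelihood (x (size u)) u.
Proof.
move=> uN ul; have [ug|ug] := boolP (good_at (size u) u).
  apply: le_trans ug; apply: ler_wpM2l; first exact: expR_ge0.
  exact: good_mass_le.
rewrite /good_mass big_pred0 ?mulr0.
  rewrite mulr_ge0 ?(ltW (w0 _)) // ltW //.
  by apply: prodr_gt0 => b _; apply: bern_gt0.
move=> v; apply/negbTE; apply: contra ug => /andP[/eqP vu] /allP /(_ (size u)).
by rewrite mem_iota /= add0n ltnS uN ul /= vu => /(_ isT).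
Qed.

(** Chernoff bound: failing the test means that the log-likelihood ratio exceeds
    [kappa * n + ln (w n)], and Markov's inequality is applied to its exponential moment of order
    [s]. *)
Lemma bad_at_mass n s : (n <= N)%N -> 0 < s ->
  \sum_(v : N.-tuple bool | ~~ good_at n (take n v)) G v <=
  expR (- (s * (kappa * n%:R + ln (w n)))) * \prod_(i < n) llr_mgf s (q i) (x n).
Proof.
move=> nN s0; rewrite -sum_path_llr // mulr_sumr.
apply: (@le_trans _ _ (\sum_(u : n.-tuple bool | ~~ good_at n u) G u)).
  rewrite big_mkcond /= [leRHS]big_mkcond /=.
  have E k (u : k.-tuple bool) (t : seq bool) :
      (if ~~ good_at n t then G u else 0) = G u * (~~ good_at n t)%:R.
    by case: good_at; rewrite ?mulr0 ?mulr1.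
  under eq_bigr do rewrite E.
  under [leRHS]eq_bigr do rewrite E.
  by rewrite (@sum_path_likelihood_take N n (fun t => (~~ good_at n t)%:R)).
rewrite big_mkcond; apply: ler_sum => u _.
have G0 := path_likelihood_gt0 u.
case: ifPn => [ub|_]; last by rewrite !mulr_ge0 ?expR_ge0 // ltW.
rewrite mulrCA -[leLHS]mulr1 ler_pM2l // -expRD -[leLHS]expR0 ler_expR.
rewrite addrC -mulrBr mulr_ge0 ?(ltW s0) // subr_ge0.
have L0 : 0 < likelihood (x n) u by apply: prodr_gt0 => b _; apply: bern_gt0.
move: ub; rewrite /good_at -ltNge => ub.
rewrite -ler_expR lnK ?posrE ?divr_gt0 // expRD lnK ?posrE //.
rewrite ler_pdivlMr // -mulrA -ler_pdivlMl ?expR_gt0 // -expRN.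
exact: ltW.
Qed.

Lemma good_mass_nil s : 0 < s ->
  1 - \sum_(n < N.+1 | late n)
        expR (- (s * (kappa * n%:R + ln (w n)))) * \prod_(i < n) llr_mgf s (q i) (x n)
  <= good_mass [::].
Proof.
move=> s0; rewrite lerBlDr -[X in X <= _](sum_path_likelihood N).
rewrite [leLHS](bigID (fun v : N.-tuple bool => good_path v)) /=; apply: lerD.
  rewrite /good_mass /=; under [leRHS]eq_bigl do rewrite take0 eqxx /=.
  by [].
apply: (@le_trans _ _ (\sum_(n < N.+1 | late n)
    \sum_(v : N.-tuple bool | ~~ good_at n (take n v)) G v)); last first.
  by apply: ler_sum => n _; apply: bad_at_mass => //; rewrite -ltnS.
under [leRHS]eq_bigr do rewrite big_mkcond /=.
rewrite exchange_big /= big_mkcond; apply: ler_sum => v _.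
have G0 := ltW (path_likelihood_gt0 v).
case: ifPn => [|_]; last by apply: sumr_ge0 => n _; case: ifP.
move=> /allPn[n]; rewrite mem_iota add0n /= => nN; rewrite negb_imply => /andP[nl nb].
rewrite (bigD1 (Ordinal nN)) //= nb lerDl.
by apply: sumr_ge0 => m _; case: ifP.
Qed.

End Path.

(** * Moment generating function of the log-likelihood ratio *)

Section Estimates.
Variable R : realType.
Implicit Types (x y s : R).

(** The difference of the two sides has derivative [t ^+ 3 / (1 + t)], which has the sign of [t]; so
    it is smallest at 0, where it vanishes. *)
Lemma ln_le_taylor3 y : -1 < y -> ln (1 + y) <= y - y ^+ 2 / 2 + y ^+ 3 / 3.
Proof.
move=> y1.
pose f (t : R) : R := t - t ^+ 2 / 2 + t ^+ 3 / 3 - ln (1 + t).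
have df (t : R) : -1 < t -> is_derive t 1 f (t ^+ 3 / (1 + t)).
  move=> t1; have t0 : 0 < 1 + t by lra.
  have dln : is_derive t 1 (fun t : R => ln (1 + t)) ((1 + t)^-1).
    have := @is_derive1_comp R (@ln R) (fun t => 1 + t) t (1 + t)^-1 1 (is_derive1_ln t0).
    rewrite mulr1; apply.
    have -> : (fun t : R => 1 + t) = (cst 1 \+ id) by [].
    by apply: is_derive_eq; rewrite add0r.
  rewrite /f.
  have -> : (fun t : R => t - t ^+ 2 / 2 + t ^+ 3 / 3 - ln (1 + t)) =
    (((id - 2^-1 *: (@id R ^+ 2)) + 3^-1 *: (@id R ^+ 3)) - (fun t : R => ln (1 + t))).
    by apply/funext => z /=; rewrite !fctE /= /GRing.scale /=; lra.
  apply: is_derive_eq.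
  rewrite /GRing.scale /= ; field; lra.
have f0 : f 0 = 0 by rewrite /f addr0 ln1; ring.
suff : 0 <= f y by rewrite /f subr_ge0.
have cf (a b : R) : -1 < a -> {within `[a, b], continuous f}.
  move=> a1; apply: derivable_within_continuous => z; rewrite in_itv /= => /andP[az _].
  by have [] := df z (lt_le_trans a1 az).
have [y0|y0] := leP 0 y.
  have [c] := @MVT_segment R f (fun t => t ^+ 3 / (1 + t)) 0 y y0
     (fun z h => df z ltac:(move: h; rewrite in_itv /= => /andP[h _]; lra)) (cf 0 y ltac:(lra)).
  rewrite in_itv /= f0 !subr0 => /andP[c0 _] ->.
  by rewrite mulr_ge0 // divr_ge0 ?exprn_ge0 //; lra.
have [c] := @MVT_segment R f (fun t => t ^+ 3 / (1 + t)) y 0 (ltW y0)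
     (fun z h => df z ltac:(move: h; rewrite in_itv /= => /andP[h _]; lra)) (cf y 0 y1).
rewrite in_itv /= f0 !sub0r => /andP[yc c0] E.
rewrite -oppr_le0 E mulr_le0_ge0 //; last by lra.
rewrite mulr_le0_ge0 // ?invr_ge0; last by lra.
by rewrite exprS mulr_le0_ge0 // sqr_ge0.
Qed.

Lemma expR_le_quad y : y <= 2^-1 -> expR y <= 1 + y + 2 * y ^+ 2.
Proof.
move=> y2; have h : 1 - y <= expR (- y) by have := expR_ge1Dx (- y).
have y1 : 0 < 1 - y by lra.
rewrite -[y in expR y]opprK expRN.
apply: (@le_trans _ _ (1 - y)^-1); first by rewrite lef_pV2 ?posrE ?expR_gt0.
rewrite -[leLHS]mul1r ler_pdivrMr //; nra.
Qed.

Lemma sin_norm_le y : `|sin y| <= `|y|.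
Proof.
have key (z : R) : 0 <= z -> `|sin z| <= z.
  move=> z0; have [c _] := @MVT_segment R (@sin R) (@cos R) 0 z z0
    (fun t _ => is_derive_sin t) (@continuous_subspaceT _ _ _ _ (@continuous_sin R)).
  rewrite sin0 !subr0 => ->; rewrite normrM (ger0_norm z0) -[leRHS]mul1r.
  by apply: ler_wpM2r => //; apply: cos_max.
have [y0|y0] := leP 0 y; first by rewrite (ger0_norm y0) key.
by rewrite -normrN -sinN (ltr0_norm y0) key // oppr_ge0 ltW.
Qed.

(** Expand [ln (1 + y)] at [y = (a - x) / x]. The first-order term is kept as it stands because it
    cancels between the two outcomes of a Bernoulli law. *)
Lemma mul_ln_ratio_le (p0 a x : R) : 0 < p0 -> p0 <= a <= 1 -> p0 <= x <= 1 ->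
  a * ln (a / x) <=
  (a - x) + (a - x) ^+ 2 / (2 * x) + `|a - x| ^+ 3 / (2 * p0 ^+ 3).
Proof.
move=> p00 /andP[pa a1] /andP[px x1].
have x0 : 0 < x by lra.
have p01 : p0 <= 1 by lra.
pose y := (a - x) / x.
have Ey : a / x = 1 + y by rewrite /y; field; lra.
have y1 : -1 < y.
  have ax0 : 0 < a / x by rewrite divr_gt0 //; lra.
  by move: ax0; rewrite Ey; lra.
rewrite Ey; apply: le_trans (ler_wpM2l _ (ln_le_taylor3 y1)) _; first by lra.
have -> : a * (y - y ^+ 2 / 2 + y ^+ 3 / 3) =
   (a - x) + (a - x) ^+ 2 / (2 * x) + (- (a - x) ^+ 3 / 6 * x ^- 2 + (a - x) ^+ 4 / 3 * x ^- 3).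
  by rewrite /y; field; lra.
rewrite lerD2l.
set t := `|a - x| ^+ 3.
have t0 : 0 <= t by rewrite exprn_ge0.
have P3 : 0 < p0 ^+ 3 by rewrite exprn_gt0.
have h2 : x ^- 2 <= p0 ^- 3.
  rewrite lef_pV2 ?posrE ?exprn_gt0 //.
  apply: (@le_trans _ _ (p0 ^+ 2)).
    by rewrite exprS ler_piMl // exprn_ge0 // ltW.
  by rewrite lerXn2r ?nnegrE // ltW.
have h3 : x ^- 3 <= p0 ^- 3.
  by rewrite lef_pV2 ?posrE ?exprn_gt0 // lerXn2r ?nnegrE // ltW.
have t3 : - (a - x) ^+ 3 <= t by rewrite /t -normrX ler_normr lexx orbT.
have t4 : (a - x) ^+ 4 <= t.
  rewrite -[leLHS]ger0_norm ?exprn_even_ge0 // normrX exprS ler_piMl //.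
  by rewrite ler_norml; apply/andP; split; lra.
have i2 : 0 <= x ^- 2 by rewrite invr_ge0 exprn_ge0 ?ltW.
have i3 : 0 <= x ^- 3 by rewrite invr_ge0 exprn_ge0 ?ltW.
have E : t / (2 * p0 ^+ 3) = t / 6 * p0 ^- 3 + t / 3 * p0 ^- 3 by field; lra.
rewrite E; apply: lerD.
  apply: (@le_trans _ _ (t / 6 * x ^- 2)); last by rewrite ler_wpM2l //; lra.
  by rewrite ler_wpM2r //; lra.
apply: (@le_trans _ _ (t / 3 * x ^- 3)); last by rewrite ler_wpM2l //; lra.
by rewrite ler_wpM2r //; lra.
Qed.

Lemma norm_ln_ratio_le (p0 a x : R) : 0 < p0 -> p0 <= a -> p0 <= x ->
  `|ln (a / x)| <= `|a - x| / p0.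
Proof.
have key (b z : R) : 0 < p0 -> p0 <= b -> p0 <= z -> ln (b / z) <= `|b - z| / p0.
  move=> p00 pb pz; have z0 : 0 < z by lra.
  have -> : b / z = 1 + (b - z) / z by field; lra.
  apply: (@le_trans _ _ ((b - z) / z)).
    apply: le_ln1Dx; rewrite -subr_gt0.
    have -> : (b - z) / z - -1 = b / z by field; lra.
    by rewrite divr_gt0 //; lra.
  apply: (@le_trans _ _ (`|b - z| / z)).
    by rewrite ler_wpM2r ?invr_ge0 ?ler_norm // ltW.
  by rewrite ler_wpM2l // lef_pV2 ?posrE.
move=> p00 pa px; rewrite ler_norml key // andbT lerNl.
have -> : - ln (a / x) = ln (x / a).
  by rewrite -lnV ?posrE ?divr_gt0 ?invf_div //; lra.
by rewrite distrC key.
Qed.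

Lemma llr_mgf_le (p0 s a x : R) : 0 < p0 -> 0 < s <= p0 / 2 ->
  p0 <= a <= 1 - p0 -> p0 <= x <= 1 - p0 ->
  llr_mgf s a x <= expR (s * ((a - x) ^+ 2 / (2 * (x * (1 - x))) + `|a - x| ^+ 3 / p0 ^+ 3)
                         + 2 * s ^+ 2 * ((a - x) ^+ 2 / p0 ^+ 2)).
Proof.
move=> p00 /andP[s0 sp] /andP[pa ap] /andP[px xp].
have step (b z : R) : p0 <= b <= 1 -> p0 <= z <= 1 ->
  b * expR (s * ln (b / z)) <= b + s * ((b - z) + (b - z) ^+ 2 / (2 * z) +
     `|b - z| ^+ 3 / (2 * p0 ^+ 3)) + b * (2 * s ^+ 2 * ((b - z) ^+ 2 / p0 ^+ 2)).
  move=> hb hz; have [/andP[pb b1] /andP[pz z1]] := (hb, hz).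
  have L := norm_ln_ratio_le p00 pb pz.
  have L1 : `|ln (b / z)| <= p0^-1.
    apply: le_trans L _; rewrite -[leRHS]mul1r ler_wpM2r ?invr_ge0 ?(ltW p00) //.
    by rewrite ler_norml; apply/andP; split; lra.
  (* The log-likelihood ratio is at most [p0^-1] in absolute value, so [s <= p0 / 2] keeps the
     exponent in the range of [expR_le_quad]. *)
  have sl : s * ln (b / z) <= 2^-1.
    apply: le_trans (ler_norm _) _; rewrite normrM gtr0_norm //.
    apply: le_trans (ler_pM (ltW s0) (normr_ge0 _) sp L1) _.
    by rewrite le_eqVlt; apply/orP; left; apply/eqP; field; lra.
  have b0 : 0 <= b by lra.
  apply: le_trans (ler_wpM2l b0 (expR_le_quad sl)) _.
  have M := mul_ln_ratio_le p00 hb hz.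
  have Q : ln (b / z) ^+ 2 <= (b - z) ^+ 2 / p0 ^+ 2.
    rewrite -(real_normK (num_real (ln _))) -(real_normK (num_real (b - z))) -expr_div_n.
    by rewrite lerXn2r ?nnegrE ?normr_ge0 // divr_ge0 // ltW.
  set l := ln (b / z) in M Q *.
  have -> : b * (1 + s * l + 2 * (s * l) ^+ 2) =
            b + s * (b * l) + b * (2 * s ^+ 2 * l ^+ 2) by ring.
  apply: lerD; first by rewrite lerD2l ler_wpM2l ?(ltW s0).
  by rewrite !ler_wpM2l // mulr_ge0 // sqr_ge0.
rewrite /llr_mgf sum_bool /bern.
have A1 : p0 <= a <= 1 by apply/andP; split; lra.
have A2 : p0 <= 1 - a <= 1 by apply/andP; split; lra.
have X1 : p0 <= x <= 1 by apply/andP; split; lra.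
have X2 : p0 <= 1 - x <= 1 by apply/andP; split; lra.
apply: le_trans (lerD (step _ _ A1 X1) (step _ _ A2 X2)) _.
apply: le_trans (expR_ge1Dx _).
have -> : 1 - a - (1 - x) = - (a - x) by ring.
rewrite normrN sqrrN.
set t := `|a - x| ^+ 3.
rewrite le_eqVlt; apply/orP; left; apply/eqP.
by field; rewrite !gt_eqF //; lra.
Qed.

(** This equals [sin (th / 2) ^+ 2], the variance-stabilizing parametrization; its inverse
    [acos (1 - 2 * p)] is the one in [c_ab]. *)
Definition angle_mean (th : R) : R := (1 - cos th) / 2.

(* In the angle [th] the Fisher information of a Bernoulli variable of mean
   [angle_mean th] is 1, which is why the exponent is [(th - th')^2 / 2] up to
   third order. *)
Lemma llr_mgf_angle_le (p0 s th th' : R) : 0 < p0 -> 0 < s <= p0 / 2 ->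
  0 <= th <= pi -> 0 <= th' <= pi ->
  p0 <= angle_mean th <= 1 - p0 -> p0 <= angle_mean th' <= 1 - p0 ->
  llr_mgf s (angle_mean th) (angle_mean th') <=
  expR (s * ((th - th') ^+ 2 / 2 + 3 / p0 ^+ 3 * `|th - th'| ^+ 3)
        + s ^+ 2 * ((th - th') ^+ 2 / p0 ^+ 2)).
Proof.
move=> p00 hs ht ht' ha hx; have /andP[s0 sp] := hs.
apply: le_trans (llr_mgf_le p00 hs ha hx) _; rewrite ler_expR.
set a := angle_mean th in ha *; set x := angle_mean th' in hx *.
set D := th - th'.
have x0 : 0 < x by move: hx => /andP[]; lra.
have x1 : 0 < 1 - x by move: hx => /andP[]; lra.
have S0 : 0 <= sin th' by apply: sin_ge0_pi.
have E2 : x * (1 - x) = sin th' ^+ 2 / 4.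
  by rewrite sin2cos2 /x /angle_mean; field.
have Sp : 2 * p0 <= sin th'.
  rewrite -(@ler_pXn2r _ 2) ?nnegrE //; last by lra.
  have -> : sin th' ^+ 2 = 4 * (x * (1 - x)) by rewrite E2; field.
  move: hx => /andP[]; nra.
(* With [m] the midpoint, the means differ by exactly [sin m * sin (D / 2)]. As [|sin m|] is at most
   [sin th' + |D| / 2], dividing the square by twice the variance [sin th' ^+ 2 / 4] leaves
   [D ^+ 2 / 2] up to third order. *)
pose m := (th + th') / 2.
have Ed : a - x = sin m * sin (D / 2).
  have E1 : th = m + D / 2 by rewrite /m /D; field.
  have E3 : th' = m - D / 2 by rewrite /m /D; field.
  by rewrite /a /x /angle_mean {1}E1 {1}E3 cosD cosB; field.
have dm : `|a - x| <= `|sin m| * (`|D| / 2).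
  rewrite Ed normrM ler_wpM2l //; apply: le_trans (sin_norm_le _) _.
  by rewrite normrM [`|2^-1|]ger0_norm.
have d2 : `|a - x| <= `|D| / 2.
  apply: le_trans dm _; rewrite -[leRHS]mul1r ler_wpM2r ?divr_ge0 //.
  exact: sin_max.
have sm : `|sin m| <= sin th' + `|D| / 2.
  have -> : m = th' + D / 2 by rewrite /m /D; field.
  rewrite sinD; apply: le_trans (ler_normD _ _) _; apply: lerD.
    by rewrite normrM (ger0_norm S0) ler_piMr // cos_max.
  rewrite normrM -[leRHS]mul1r ler_pM ?cos_max //.
  by apply: le_trans (sin_norm_le _) _; rewrite normrM [`|2^-1|]ger0_norm.
pose e := `|D|.
have e0 : 0 <= e by exact: normr_ge0.
have e4 : e <= 4.
  have p4 : pi < 4 :> R by have := pihalf_lt2 R; lra.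
  by rewrite /e ler_norml /D; apply/andP; split; lra.
have ED : D ^+ 2 = e ^+ 2 by rewrite /e real_normK ?num_real.
have EA : (a - x) ^+ 2 = `|a - x| ^+ 2 by rewrite real_normK ?num_real.
have K1 : (a - x) ^+ 2 / (2 * (x * (1 - x))) <= e ^+ 2 / 2 + 2 / p0 ^+ 3 * e ^+ 3.
  pose S := sin th'; pose t := e / (2 * S); pose i := p0^-1.
  have S1 : 0 < S by rewrite /S; lra.
  have i0 : 0 < i by rewrite invr_gt0.
  have i1 : 1 <= i.
    have : p0 * i = 1 by rewrite /i divff // gt_eqF.
    by move: hx => /andP[]; nra.
  have t0 : 0 <= t by rewrite divr_ge0 // mulr_ge0 // ltW.
  have t1 : t <= e * i / 4.
    have -> : e * i / 4 = e * (4 * p0)^-1 by rewrite /i; field; lra.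
    by rewrite ler_wpM2l // lef_pV2 ?posrE; rewrite /S; lra.
  have -> : (a - x) ^+ 2 / (2 * (x * (1 - x))) = 2 * (`|a - x| / S) ^+ 2.
    by rewrite E2 EA -/S; field; lra.
  have q1 : `|a - x| / S <= e / 2 * (1 + t).
    rewrite ler_pdivrMr //; apply: le_trans dm _.
    have -> : e / 2 * (1 + t) * S = (S + e / 2) * (e / 2) by rewrite /t; field; lra.
    by rewrite ler_wpM2r ?divr_ge0.
  apply: (@le_trans _ _ (2 * (e / 2 * (1 + t)) ^+ 2)).
    rewrite ler_wpM2l // lerXn2r ?nnegrE ?divr_ge0 ?(ltW S1) //.
    by rewrite mulr_ge0 ?divr_ge0 //; lra.
  have -> : 2 * (e / 2 * (1 + t)) ^+ 2 = e ^+ 2 / 2 + e ^+ 2 * (t * (1 + t / 2)) by field.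
  have -> : 2 / p0 ^+ 3 * e ^+ 3 = e ^+ 2 * (e * (2 * i ^+ 3)) by rewrite /i; field; lra.
  rewrite lerD2l ler_wpM2l ?sqr_ge0 //.
  have t2 : t <= i by nra.
  have i3 : i <= i ^+ 3 by rewrite exprS ler_peMr ?(ltW i0) // exprn_ege1.
  have i23 : i ^+ 2 <= i ^+ 3 by rewrite [leRHS]exprS ler_peMl // sqr_ge0.
  apply: (@le_trans _ _ (e * i / 4 * (1 + i / 2))).
    by rewrite ler_pM //; lra.
  have -> : e * i / 4 * (1 + i / 2) = e * (i / 4 + i ^+ 2 / 8) by field.
  by rewrite ler_wpM2l //; lra.
have K2 : `|a - x| ^+ 3 / p0 ^+ 3 <= e ^+ 3 / p0 ^+ 3.
  apply: ler_wpM2r; first by rewrite invr_ge0 exprn_ge0 // ltW.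
  by rewrite lerXn2r ?nnegrE //; apply: le_trans d2 _; rewrite -/e; lra.
have K3 : (a - x) ^+ 2 / p0 ^+ 2 <= e ^+ 2 / 4 / p0 ^+ 2.
  rewrite EA; apply: ler_wpM2r; first by rewrite invr_ge0 exprn_ge0 // ltW.
  have -> : e ^+ 2 / 4 = (e / 2) ^+ 2 by field.
  by rewrite lerXn2r ?nnegrE //; lra.
rewrite ED; apply: lerD.
  rewrite ler_wpM2l ?(ltW s0) //; apply: le_trans (lerD K1 K2) _.
  by rewrite le_eqVlt; apply/orP; left; apply/eqP; rewrite -/e; field; lra.
apply: le_trans (ler_wpM2l _ K3) _; first by rewrite mulr_ge0 // sqr_ge0.
have : 0 <= e ^+ 2 / p0 ^+ 2 by rewrite divr_ge0 // sqr_ge0.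
set f := _ / p0 ^+ 2 => f0.
have -> : e ^+ 2 / 4 / p0 ^+ 2 = f / 4 by rewrite /f; field; lra.
have := sqr_ge0 s; nra.
Qed.

End Estimates.

(** * Logarithmic sums *)

Section LogSums.
Variable R : realType.

Definition log_ratio (n i : nat) : R := ln n%:R - ln i.+1%:R.

Lemma log_ratio_ge0 n i : (i < n)%N -> 0 <= log_ratio n i.
Proof.
move=> iN; rewrite subr_ge0 ler_ln ?posrE ?ltr0n ?ler_nat //.
exact: leq_trans iN.
Qed.

(** Going from [n] to [n.+1] adds [h n] to every [log_ratio], and [n * h n] is at most 1; the
    inductions below rest on this. The convention [ln 0 = 0] gives [h 0 = 0]. *)
Let h (n : nat) : R := ln n.+1%:R - ln n%:R.

Let h_ge0 n : 0 <= h n.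
Proof.
case: n => [|n]; first by rewrite /h ln1 ln0 // subrr.
by rewrite /h subr_ge0 ler_ln ?posrE ?ltr0n ?ler_nat.
Qed.

Let nh_le1 n : n%:R * h n <= 1.
Proof.
case: n => [|n]; first by rewrite mul0r.
have n0 : 0 < n.+1%:R :> R by rewrite ltr0n.
rewrite mulrC -ler_pdivlMr // /h -ln_div ?posrE //.
have -> : n.+2%:R / n.+1%:R = 1 + n.+1%:R^-1 :> R.
  by rewrite -(natr1 n.+1) mulrDl divff ?gt_eqF // mul1r.
rewrite div1r; apply: le_ln1Dx; apply: lt_trans (_ : 0 < _); first by lra.
by rewrite invr_gt0.
Qed.

Let h_le1 n : h n <= 1.
Proof.
case: n => [|n]; first by rewrite /h ln1 ln0 // subrr.
apply: le_trans (nh_le1 n.+1); rewrite ler_peMl // ?h_ge0 //.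
by rewrite ler1n.
Qed.

Let log_ratioS n i : log_ratio n.+1 i = log_ratio n i + h n.
Proof. by rewrite /log_ratio /h; ring. Qed.

Let log_ratio_last n : log_ratio n.+1 n = 0.
Proof. by rewrite /log_ratio subrr. Qed.

Lemma sum_log_ratio_le n : \sum_(i < n) log_ratio n i <= n%:R.
Proof.
elim: n => [|n IH]; first by rewrite big_ord0.
rewrite big_ord_recr /= log_ratio_last addr0.
under eq_bigr do rewrite log_ratioS.
rewrite big_split /= sumr_const card_ord -[h n *+ n]mulr_natl.
by rewrite -natr1; apply: lerD.
Qed.

Lemma sum_log_ratio_sq_le n : \sum_(i < n) log_ratio n i ^+ 2 <= 3 * n%:R.
Proof.
elim: n => [|n IH]; first by rewrite big_ord0 mulr0.
rewrite big_ord_recr /= log_ratio_last expr0n /= addr0.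
under eq_bigr do rewrite log_ratioS sqrrD -mulr_natr -mulrA.
rewrite !big_split /= -mulr_suml sumr_const card_ord -[_ *+ n]mulr_natl.
have S1 := sum_log_ratio_le n; rewrite -(natr1 n).
have := h_ge0 n; have := nh_le1 n; have := h_le1 n.
set S := \sum_(i < n) log_ratio n i in S1 *; set k := h n; set m := n%:R in S1 IH *.
move=> k1 mk k0; have Sk : S * k <= 1 by apply: le_trans mk; rewrite ler_wpM2r.
have mk2 : m * k ^+ 2 <= 1.
  by rewrite expr2 mulrA; apply: le_trans (ler_wpM2r k0 mk) _; rewrite mul1r.
lra.
Qed.

(** The three correction terms of an induction step are at most 9, 3 and 1, whence 13. *)
Lemma sum_log_ratio_cube_le n : \sum_(i < n) log_ratio n i ^+ 3 <= 13 * n%:R.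
Proof.
elim: n => [|n IH]; first by rewrite big_ord0 mulr0.
rewrite big_ord_recr /= log_ratio_last expr0n /= addr0.
under eq_bigr => i _.
  rewrite log_ratioS (_ : (_ + h n) ^+ 3 = log_ratio n i ^+ 3 +
    log_ratio n i ^+ 2 * (3 * h n) + log_ratio n i * (3 * h n ^+ 2) + h n ^+ 3); last by ring.
  over.
rewrite !big_split /= -!mulr_suml sumr_const card_ord -[_ *+ n]mulr_natl.
have S1 := sum_log_ratio_le n; have S2 := sum_log_ratio_sq_le n; rewrite -(natr1 n).
have := h_ge0 n; have := nh_le1 n; have := h_le1 n.
set S := \sum_(i < n) log_ratio n i in S1 *.
set T := \sum_(i < n) log_ratio n i ^+ 2 in S2 *.
set k := h n; set m := n%:R in S1 S2 IH *.
move=> k1 mk k0; have Sk : S * k <= 1 by apply: le_trans mk; rewrite ler_wpM2r.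
have Tk : T * k <= 3.
  by apply: le_trans (ler_wpM2r k0 S2) _; rewrite -mulrA; lra.
have Skk : S * (3 * k ^+ 2) <= 3.
  rewrite expr2 (_ : _ * _ = 3 * (S * k * k)); last by ring.
  by have := ler_wpM2r k0 Sk; lra.
have mk3 : m * k ^+ 3 <= 1.
  have -> : m * k ^+ 3 = m * k * (k * k) by ring.
  have kk : 0 <= k * k <= 1 by rewrite mulr_ge0 // mulr_ile1.
  by nra.
have -> : T * (3 * k) = 3 * (T * k) by ring.
lra.
Qed.

Lemma sum_log_ratio_shift_cube_le n :
  \sum_(i < n) (log_ratio n i + 2) ^+ 3 <= 51 * n%:R.
Proof.
under eq_bigr => i _.
  rewrite (_ : (_ + 2) ^+ 3 = log_ratio n i ^+ 3 +
    log_ratio n i ^+ 2 * 6 + log_ratio n i * 12 + 8); last by ring.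
  over.
rewrite !big_split /= -!mulr_suml sumr_const card_ord -[_ *+ n]mulr_natl.
have := sum_log_ratio_le n; have := sum_log_ratio_sq_le n; have := sum_log_ratio_cube_le n.
lra.
Qed.

(* The discrete form of [\int_0^1 (ln (1/y) - 1)^2 dy = 1]. *)
Lemma sum_log_ratio_centered_sq_le n : (0 < n)%N ->
  \sum_(i < n) (log_ratio n i - 1) ^+ 2 <= n%:R + ln n%:R.
Proof.
case: n => // n _; elim: n => [|n IH].
  by rewrite big_ord1 /log_ratio subrr ln1 sub0r sqrrN expr1n addr0.
rewrite big_ord_recr /= log_ratio_last sub0r sqrrN expr1n.
under eq_bigr => i _.
  rewrite log_ratioS (_ : (_ + h n.+1 - 1) ^+ 2 = (log_ratio n.+1 i - 1) ^+ 2 +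
    (log_ratio n.+1 i - 1) * (2 * h n.+1) + h n.+1 ^+ 2); last by ring.
  over.
rewrite big_split /= big_split /= sumr_const card_ord -[h n.+1 ^+ 2 *+ n.+1]mulr_natl -mulr_suml.
(* The cross term is a nonnegative multiple of this nonpositive sum. What remains is
   [n * h ^+ 2 <= h], and the [h] telescope to the logarithm in the bound. *)
have S1 : \sum_(i < n.+1) (log_ratio n.+1 i - 1) <= 0.
  by rewrite big_split /= sumr_const card_ord mulNrn subr_le0 sum_log_ratio_le.
have -> : ln n.+2%:R = ln n.+1%:R + h n.+1 by rewrite /h; ring.
rewrite -(natr1 n.+1).
have := h_ge0 n.+1; have := nh_le1 n.+1.
set k := h n.+1 => mk k0.
have Sk : (\sum_(i < n.+1) (log_ratio n.+1 i - 1)) * (2 * k) <= 0.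
  by rewrite mulr_le0_ge0 // mulr_ge0.
have mk2 : n.+1%:R * k ^+ 2 <= k.
  by rewrite expr2 mulrA; apply: le_trans (ler_wpM2r k0 mk) _; rewrite mul1r.
lra.
Qed.

End LogSums.

(** * Drifting angles *)

Section AnglePath.
Variables (R : realType) (lo hi p0 sigma a : R).
Hypotheses (lo0 : 0 <= lo) (hipi : hi <= pi) (p00 : 0 < p0).
Hypothesis mean_bounds : forall th, lo <= th <= hi -> p0 <= angle_mean th <= 1 - p0.
Hypothesis sigma0 : 0 <= sigma.

(* An arm of angle [th] after [expR y] pulls: at first it keeps its own mean,
   then its angle decreases at constant speed in [y], until it reaches [lo]. *)
Definition angle_path (th y : R) : R :=
  Num.max lo (th - sigma * Num.max 0 (y - a)).

Let max_lip (c y z : R) : `|Num.max c y - Num.max c z| <= `|y - z|.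
Proof.
case: (leP c y) => h1; case: (leP c z) => h2 //.
- by rewrite !ger0_norm; lra.
- by rewrite !ler0_norm; lra.
- by rewrite subrr normr0.
Qed.

Lemma angle_path_lip th y z :
  `|angle_path th y - angle_path th z| <= sigma * `|y - z|.
Proof.
apply: le_trans (max_lip _ _ _) _.
rewrite (_ : _ - _ - _ = sigma * (Num.max 0 (z - a) - Num.max 0 (y - a))); last by ring.
rewrite normrM (ger0_norm sigma0) ler_wpM2l // distrC; apply: le_trans (max_lip _ _ _) _.
by rewrite (_ : y - a - (z - a) = y - z) //; ring.
Qed.

Lemma angle_path_bounds th y : lo <= th <= hi -> lo <= angle_path th y <= hi.
Proof.
move=> /andP[h1 h2]; rewrite /angle_path le_max lexx /= ge_max (le_trans h1 h2) /=.
have : 0 <= sigma * Num.max 0 (y - a) by rewrite mulr_ge0 // le_max lexx.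
by lra.
Qed.

Lemma angle_path_early th y : lo <= th -> y <= a -> angle_path th y = th.
Proof.
move=> h ya; rewrite /angle_path; have -> : Num.max 0 (y - a) = 0.
  by apply/max_idPl; lra.
by rewrite mulr0 subr0; apply/max_idPr.
Qed.

Lemma angle_path_late th y : th <= hi -> hi - lo <= sigma * (y - a) ->
  angle_path th y = lo.
Proof.
move=> h ya; apply/max_idPl.
have : sigma * (y - a) <= sigma * Num.max 0 (y - a) by rewrite ler_wpM2l // le_max lexx orbT.
by lra.
Qed.

(** The path is Lipschitz in logarithmic time and passes near [th'] at time [ln n - 1], so at pull
    [i] it is within [sigma * (|log_ratio n i - 1| + delta)] of [th']. The centered square sum then
    controls the main term, and 153 is 3 times 51. *)
Lemma prod_llr_mgf_path_le (n : nat) (th th' delta s V : R) : (0 < n)%N ->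
  lo <= th <= hi -> lo <= th' <= hi -> 0 <= delta <= 1 -> 0 < s <= p0 / 2 ->
  `|angle_path th (ln n%:R - 1) - th'| <= sigma * delta ->
  V = (1 + delta) * (n%:R + ln n%:R) + 2 * delta * n%:R ->
  \prod_(i < n) llr_mgf s (angle_mean (angle_path th (ln i.+1%:R))) (angle_mean th') <=
  expR (s * (sigma ^+ 2 * V / 2 + 153 / p0 ^+ 3 * sigma ^+ 3 * n%:R)
        + s ^+ 2 * (sigma ^+ 2 * V / p0 ^+ 2)).
Proof.
move=> n0 hth hth' /andP[d0 d1] hs near_th' VE; have /andP[s0 _] := hs.
pose c2 : R := s / 2 + s ^+ 2 / p0 ^+ 2.
pose c3 : R := s * (3 / p0 ^+ 3).
have c20 : 0 <= c2.
  by rewrite addr_ge0 // ?divr_ge0 ?sqr_ge0 // ltW.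
have c30 : 0 <= c3 by rewrite mulr_ge0 ?(ltW s0) // divr_ge0 // exprn_ge0 // ltW.
pose y (i : nat) : R := log_ratio R n i - 1.
have step (i : 'I_n) : llr_mgf s (angle_mean (angle_path th (ln i.+1%:R))) (angle_mean th') <=
   expR (c2 * (sigma ^+ 2 * ((1 + delta) * y i ^+ 2 + 2 * delta)) +
         c3 * (sigma ^+ 3 * (log_ratio R n i + 2) ^+ 3)).
  have /andP[l1 l2] := angle_path_bounds (ln i.+1%:R) hth.
  have /andP[l3 l4] := hth'.
  have r1 : 0 <= angle_path th (ln i.+1%:R) <= pi by rewrite (le_trans lo0 l1) (le_trans l2 hipi).
  have r2 : 0 <= th' <= pi by rewrite (le_trans lo0 l3) (le_trans l4 hipi).
  have r3 := mean_bounds (angle_path_bounds (ln i.+1%:R) hth).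
  apply: le_trans (llr_mgf_angle_le p00 hs r1 r2 r3 (mean_bounds hth')) _.
  rewrite ler_expR; set D := _ - th'.
  have yi0 := @log_ratio_ge0 R n i (ltn_ord i).
  have D1 : `|D| <= sigma * (`|y i| + delta).
    rewrite mulrDr; apply: le_trans (lerD _ near_th').
      rewrite /D (_ : _ - th' = (angle_path th (ln i.+1%:R) - angle_path th (ln n%:R - 1)) +
         (angle_path th (ln n%:R - 1) - th')); last by ring.
      exact: ler_normD.
    apply: le_trans (angle_path_lip _ _ _) _; rewrite ler_wpM2l // distrC.
    by rewrite /y /log_ratio (_ : _ - 1 - _ = ln n%:R - ln i.+1%:R - 1) //; ring.
  have D2 : D ^+ 2 <= sigma ^+ 2 * ((1 + delta) * y i ^+ 2 + 2 * delta).
    rewrite -(real_normK (num_real D)); apply: (@le_trans _ _ ((sigma * (`|y i| + delta)) ^+ 2)).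
      by rewrite lerXn2r ?nnegrE // mulr_ge0 // addr_ge0.
    rewrite exprMn ler_wpM2l ?sqr_ge0 // -(real_normK (num_real (y i))).
    have := normr_ge0 (y i); set z := `|y i| => z0.
    (* The square of [z + delta] is below [(1 + delta) * z ^+ 2 + 2 * delta]: the gap is [delta * (z
       - 1) ^+ 2 + delta * (1 - delta)]. *)
    have : 0 <= delta * (z - 1) ^+ 2 by rewrite mulr_ge0 // sqr_ge0.
    by nra.
  have D3 : `|D| ^+ 3 <= sigma ^+ 3 * (log_ratio R n i + 2) ^+ 3.
    rewrite -exprMn lerXn2r ?nnegrE ?mulr_ge0 //; first by lra.
    apply: le_trans D1 _; rewrite ler_wpM2l //.
    have : `|y i| <= log_ratio R n i + 1 by rewrite /y ler_norml; apply/andP; split; lra.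
    by lra.
  have := ler_wpM2l c20 D2; have := ler_wpM2l c30 D3; rewrite /c2 /c3; lra.
apply: (@le_trans _ _ (\prod_(i < n)
  expR (c2 * (sigma ^+ 2 * ((1 + delta) * y i ^+ 2 + 2 * delta)) +
         c3 * (sigma ^+ 3 * (log_ratio R n i + 2) ^+ 3)))).
  apply: ler_prod => i _; rewrite step andbT /llr_mgf.
  have /andP[m1 m2] := mean_bounds (angle_path_bounds (ln i.+1%:R) hth).
  by apply: sumr_ge0 => b _; rewrite mulr_ge0 ?expR_ge0 // /bern; case: b; lra.
rewrite -expR_sum ler_expR big_split /= -!mulr_sumr big_split /= -mulr_sumr.
rewrite sumr_const card_ord -[(2 * delta) *+ n]mulr_natr.
have S2 := @sum_log_ratio_centered_sq_le R n n0.
have S3 := @sum_log_ratio_shift_cube_le R n.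
have d10 : 0 <= 1 + delta by lra.
have S2' := ler_wpM2l d10 S2.
have S2'' : sigma ^+ 2 * ((1 + delta) * (\sum_(i < n) (log_ratio R n i - 1) ^+ 2) +
    2 * delta * n%:R) <= sigma ^+ 2 * V.
  by rewrite ler_wpM2l ?sqr_ge0 // VE lerD2r.
have S3' : sigma ^+ 3 * (\sum_(i < n) (log_ratio R n i + 2) ^+ 3) <= sigma ^+ 3 * (51 * n%:R).
  by rewrite ler_wpM2l ?exprn_ge0.
have := ler_wpM2l c20 S2''; have := ler_wpM2l c30 S3'.
rewrite /c2 /c3 /y; lra.
Qed.

End AnglePath.

(** * Summing the Chernoff bounds over late times *)

Section Asymptotics.
Variables (R : realType) (lo hi p0 eps delta s kap mu sig0 Cw : R).
Hypotheses (lo0 : 0 <= lo) (hipi : hi <= pi) (p00 : 0 < p0).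
Hypothesis mean_bounds : forall th, lo <= th <= hi -> p0 <= angle_mean th <= 1 - p0.
Hypotheses (eps0 : 0 < eps) (delta0 : 0 < delta) (delta1 : delta <= 1).
Hypotheses (s0 : 0 < s) (sp : s <= p0 / 2) (mu0 : 0 < mu) (mu1 : mu <= 1).
Hypotheses (sig00 : 0 <= sig0) (Cw0 : 0 <= Cw).
Hypothesis slack :
  sig0 ^+ 2 / 2 * (1 + 5 * delta) + 6 * s * sig0 ^+ 2 / p0 ^+ 2 <= kap - 2 * mu.

(** The constant comes from [(eps * l / 6) ^+ 6 <= expR (eps * l)]: a sixth power divided by
    [l ^+ 2] still beats the cost [Cw * l ^+ 2] of the atom masses. *)
Let b := mu * (eps / 6) ^+ 6.
Let b0 : 0 < b.
Proof. by rewrite /b mulr_gt0 // exprn_gt0 // divr_gt0. Qed.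

(** Of the [2 * mu] reserved by [slack], one [mu] absorbs the cubic remainder once [l] is large, and
    the other turns [n > expR (eps * l)] into the decay [b * l ^+ 4]. *)
Lemma late_term_le (l w P : R) (n : nat) :
  1 <= l -> 2 / (eps * delta) <= l -> 153 / p0 ^+ 3 * sig0 ^+ 3 / mu <= l ->
  0 < w -> - ln w <= Cw * l ^+ 2 -> eps * l < ln n%:R ->
  (forall V, V = (1 + delta) * (n%:R + ln n%:R) + 2 * delta * n%:R ->
   P <= expR (s * ((sig0 / l) ^+ 2 * V / 2 + 153 / p0 ^+ 3 * (sig0 / l) ^+ 3 * n%:R)
        + s ^+ 2 * ((sig0 / l) ^+ 2 * V / p0 ^+ 2))) ->
  expR (- (s * (kap / l ^+ 2 * n%:R + ln w))) * P <= expR (s * (Cw * l ^+ 2 - b * l ^+ 4)).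
Proof.
move=> l1 l2 l3 w0 hw ln_n /(_ _ erefl) hP.
have [[dl0 dl1] sl] := (delta0, delta1, slack).
have l0 : 0 < l by lra.
have n0 : 0 < n%:R :> R.
  rewrite ltr0n lt0n; apply/eqP => n0; move: ln_n; rewrite n0 ln0 //.
  by rewrite ltNge mulr_ge0 // ltW.
have en : expR (eps * l) <= n%:R by rewrite -[leRHS]lnK ?posrE // ler_expR ltW.
have lnn : ln n%:R <= delta * n%:R.
  set y := ln n%:R in ln_n *.
  have -> : n%:R = expR y by rewrite lnK ?posrE.
  have y0 : 0 < y by apply: lt_trans ln_n; rewrite mulr_gt0.
  have := @expR_ge1Dxn R y 1 (ltW y0); rewrite (_ : 2`! = 2)%N // => h.
  have y2 : 2 <= delta * y.
    have : delta * (eps * l) <= delta * y by rewrite ler_wpM2l // ltW.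
    apply: le_trans; move: l2; rewrite ler_pdivrMr ?mulr_gt0 //; lra.
  apply: (@le_trans _ _ (delta * (y ^+ 2 / 2))).
    have -> : delta * (y ^+ 2 / 2) = delta * y / 2 * y by field.
    by rewrite ler_peMl //; lra.
  by rewrite ler_wpM2l ?(ltW delta0) //; lra.
set m : R := n%:R in n0 en lnn hP *.
set V := (1 + delta) * _ + _ in hP.
(* The coefficient is [(1 + delta) ^+ 2 + 2 * delta], with [delta ^+ 2 <= delta]. *)
have V1 : V <= (1 + 5 * delta) * m.
  have : (1 + delta) * ln m <= (1 + delta) * (delta * m) by rewrite ler_wpM2l //; lra.
  have dd : delta * delta <= delta by rewrite ler_piMr // ltW.
  have := ler_wpM2r (ltW n0) dd.
  by rewrite /V; lra.
have V6 : V <= 6 * m.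
  apply: le_trans V1 _; rewrite ler_wpM2r ?(ltW n0) //; lra.
pose q := m / l ^+ 2.
have L2 : 0 < l ^+ 2 by rewrite exprn_gt0.
have q0 : 0 <= q by rewrite divr_ge0 // ltW.
have T1 : (sig0 / l) ^+ 2 * V / 2 <= sig0 ^+ 2 / 2 * (1 + 5 * delta) * q.
  have -> : sig0 ^+ 2 / 2 * (1 + 5 * delta) * q =
    (sig0 / l) ^+ 2 * ((1 + 5 * delta) * m) / 2 by rewrite /q; field; lra.
  by rewrite ler_wpM2r // ler_wpM2l // sqr_ge0.
have T2 : 153 / p0 ^+ 3 * (sig0 / l) ^+ 3 * m <= mu * q.
  have -> : 153 / p0 ^+ 3 * (sig0 / l) ^+ 3 * m = (153 / p0 ^+ 3 * sig0 ^+ 3 / l) * q.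
    by rewrite /q; field; rewrite !gt_eqF.
  by rewrite ler_wpM2r // ler_pdivrMr // [mu * l]mulrC -ler_pdivrMr.
have T3 : s * ((sig0 / l) ^+ 2 * V / p0 ^+ 2) <= 6 * s * sig0 ^+ 2 / p0 ^+ 2 * q.
  have -> : 6 * s * sig0 ^+ 2 / p0 ^+ 2 * q = s * ((sig0 / l) ^+ 2 * (6 * m) / p0 ^+ 2).
    by rewrite /q; field; rewrite !gt_eqF.
  by rewrite ler_wpM2l ?(ltW s0) // ler_wpM2r ?invr_ge0 ?sqr_ge0 // ler_wpM2l // sqr_ge0.
have q1 : b * l ^+ 4 <= mu * q.
  have -> : b * l ^+ 4 = mu * ((eps * l / 6) ^+ 6 / l ^+ 2) by rewrite /b; field; lra.
  rewrite ler_wpM2l ?(ltW mu0) // ler_wpM2r ?invr_ge0 ?(ltW L2) //.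
  apply: le_trans en; have e0 : 0 <= eps * l by rewrite mulr_ge0 // ltW.
  have -> : expR (eps * l) = expR (eps * l / 6) ^+ 6.
    by rewrite -expRM_natl; congr expR; field.
  rewrite lerXn2r ?nnegrE ?expR_ge0 ?divr_ge0 //.
  by apply: le_trans (expR_ge1Dx _); lra.
apply: le_trans (ler_wpM2l (expR_ge0 _) hP) _.
rewrite -expRD ler_expR.
set X := (sig0 / l) ^+ 2 * V / 2 in T1 *.
set Y := 153 / p0 ^+ 3 * (sig0 / l) ^+ 3 * m in T2 *.
set Z := (sig0 / l) ^+ 2 * V / p0 ^+ 2 in T3 *.
have -> : - (s * (kap / l ^+ 2 * m + ln w)) + (s * (X + Y) + s ^+ 2 * Z) =
   s * (X + Y + s * Z - kap * q - ln w) by rewrite /q; field; lra.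
rewrite ler_wpM2l ?(ltW s0) //.
have := ler_wpM2r q0 slack; lra.
Qed.

(** At most [expR (2 * l)] terms, each below [expR (s * (Cw * l ^+ 2 - b * l ^+ 4))], sum to at most
    [expR (- l)], which is below half of the allowed loss [mu / l ^+ 2]. *)
Lemma late_sum_le : exists l0, forall (N : nat) (l : R), l = ln N%:R -> l0 <= l ->
  forall (th : R) (th' w : nat -> R), lo <= th <= hi ->
  (forall n, lo <= th' n <= hi) -> (forall n, 0 < w n /\ - ln (w n) <= Cw * l ^+ 2) ->
  (forall n, `|angle_path lo (sig0 / l) (eps * l) th (ln n%:R - 1) - th' n| <= sig0 / l * delta) ->
  expR (- (mu / l ^+ 2)) <=
  1 - \sum_(n < N.+1 | eps * l < ln n%:R)
        expR (- (s * (kap / l ^+ 2 * n%:R + ln (w n)))) *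
        \prod_(i < n) llr_mgf s (angle_mean (angle_path lo (sig0 / l) (eps * l) th (ln i.+1%:R)))
                        (angle_mean (th' n)).
Proof.
(* [L1] and [L2] are the thresholds of [late_term_le]; [L3] lets [b * l ^+ 4] win over the mass cost
   and the number of terms; [L4] compares [expR (- l)] with [mu / l ^+ 2]. *)
pose L1 := 2 / (eps * delta); pose L2 := 153 / p0 ^+ 3 * sig0 ^+ 3 / mu.
pose L3 := (3 + s * Cw) / (s * b); pose L4 := 12 / mu.
have L10 : 0 <= L1 by rewrite divr_ge0 // mulr_ge0 // ltW.
have L20 : 0 <= L2.
  by rewrite !mulr_ge0 ?invr_ge0 ?exprn_ge0 // ltW.
have L30 : 0 <= L3.
  apply: divr_ge0; last exact: (mulr_ge0 (ltW s0) (ltW b0)).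
  by apply: addr_ge0 => //; exact: (mulr_ge0 (ltW s0) Cw0).
have L40 : 0 <= L4 by rewrite divr_ge0 // ltW.
exists (1 + L1 + L2 + L3 + L4) => N l lE hl th th' w hth hth' hw near.
have l1 : 1 <= l by lra.
have l0 : 0 < l by lra.
have m0 := mu0.
have N0 : 0 < N%:R :> R.
  by rewrite ltr0n lt0n; apply/eqP => N0; move: l0; rewrite lE N0 ln0 // ltxx.
have sigma0 : 0 <= sig0 / l by rewrite divr_ge0 // ltW.
have hs : 0 < s <= p0 / 2 by rewrite s0.
have S : \sum_(n < N.+1 | eps * l < ln n%:R)
        expR (- (s * (kap / l ^+ 2 * n%:R + ln (w n)))) *
        \prod_(i < n) llr_mgf s (angle_mean (angle_path lo (sig0 / l) (eps * l) th (ln i.+1%:R)))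
                        (angle_mean (th' n)) <= expR (- l).
  apply: (@le_trans _ _ (\sum_(n < N.+1) expR (s * (Cw * l ^+ 2 - b * l ^+ 4)))).
    rewrite big_mkcond; apply: ler_sum => n _; case: ifP => [hn|_]; last exact: expR_ge0.
    have [w0 w1] := hw n.
    apply: late_term_le => //; [by rewrite -/L1; lra|by rewrite -/L2; lra|].
    move=> V VE; apply: (prod_llr_mgf_path_le lo0 hipi p00 mean_bounds sigma0) VE => //.
    - rewrite lt0n; apply/eqP => n0; move: hn; rewrite n0 ln0 // ltNge.
      by rewrite mulr_ge0 // ltW.
    - by rewrite (ltW delta0).
  rewrite sumr_const card_ord -mulr_natl.
  apply: (@le_trans _ _ (expR (2 * l) * expR (s * (Cw * l ^+ 2 - b * l ^+ 4)))).
    apply: ler_wpM2r; first exact: expR_ge0.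
    have -> : 2 * l = l + l by ring.
    rewrite expRD lE lnK ?posrE // -natr1.
    have : 1 + l <= N%:R by rewrite -[leRHS]lnK ?posrE // -lE expR_ge1Dx.
    nra.
  rewrite -expRD ler_expR.
  have h3 : (3 + s * Cw) <= s * b * l.
    have sb0 : 0 < s * b by exact: mulr_gt0 s0 b0.
    have L3l : L3 <= l by lra.
    by rewrite /L3 ler_pdivrMr // in L3l; rewrite [leRHS]mulrC.
  have l2 : 1 <= l ^+ 2 by rewrite exprn_ege1.
  have hl2 : l <= l ^+ 2 by rewrite expr2 ler_peMl // ltW.
  have : (3 + s * Cw) * l ^+ 2 <= s * b * l ^+ 4.
    have -> : s * b * l ^+ 4 = s * b * l * l * l ^+ 2 by ring.
    rewrite ler_wpM2r ?sqr_ge0 //; apply: le_trans h3 _.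
    apply: ler_peMr => //; apply: mulr_ge0 (ltW l0).
    exact: (mulr_ge0 (ltW s0) (ltW b0)).
  lra.
apply: (@le_trans _ _ (1 - expR (- l))); last by rewrite lerD2l lerN2.
pose z := mu / l ^+ 2.
have z0 : 0 <= z by rewrite divr_ge0 ?sqr_ge0 // ltW.
have lsq : 0 < l ^+ 2 by rewrite exprn_gt0.
have z1 : z <= 1 by rewrite ler_pdivrMr // mul1r; apply: le_trans mu1 _; rewrite exprn_ege1.
have Ez : expR (- z) <= 1 - z / 2.
  rewrite expRN; apply: (@le_trans _ _ (1 + z)^-1).
    by rewrite lef_pV2 ?posrE ?expR_gt0 ?expR_ge1Dx //; lra.
  rewrite -[leLHS]mul1r ler_pdivrMr; last by lra.
  by nra.
have El : expR (- l) <= z / 2.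
  rewrite expRN -[leLHS]mul1r ler_pdivrMr ?expR_gt0 //.
  have h : l ^+ 3 / 6 <= expR l.
    by have := @expR_ge1Dxn R l 2 (ltW l0); rewrite (_ : 3`! = 6)%N //; lra.
  apply: le_trans (ler_wpM2l (divr_ge0 z0 (ler0n _ 2)) h).
  have -> : z / 2 * (l ^+ 3 / 6) = mu * l / 12 by rewrite /z; field; lra.
  have : L4 <= l by lra.
  by rewrite ler_pdivrMr // => h4; lra.
rewrite -/z; lra.
Qed.

End Asymptotics.

(** * Reservoirs with atoms *)

Section Atoms.
Variables (R : realType) (mu : probability R R).
Variables (K : nat) (m x : nat -> R).
Hypothesis m0 : forall k, 0 <= m k.
Hypothesis atoms : forall z, ((\sum_(k < K | x k == z) m k)%:E <= mu [set z])%E.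

Import HBNNSimple.

Lemma sintegral_sum_nnsfun (f : {nnsfun R >-> R}^nat) n :
  sintegral mu (sum_nnsfun f n) = (\sum_(i < n) sintegral mu (f i))%E.
Proof.
elim: n => [|n IH]; first by rewrite /sum_nnsfun !big_ord0 sintegral0.
rewrite big_ord_recr /= -IH -sintegralD; apply: eq_sintegral => z /=.
by rewrite sum_nnsfunE big_ord_recr /= -sum_nnsfunE.
Qed.

(* No measurability of [f] is needed: the simple function carried by the atoms
   lies below [f]. *)
Let nonneg_integral_atoms_ge (f : R -> \bar R) (g : R -> R) :
  (forall z, 0 <= g z) -> (forall z, ((g z)%:E <= f z)%E) ->
  ((\sum_(k < K) m k * g (x k))%:E <= \int[mu]_z f z)%E.
Proof.
move=> g0 gf.
(* Indices carried by the same point are merged, so that the indicators summed below have disjoint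
   supports. *)
pose s := undup [seq x k | k <- iota 0 K].
pose h (i : nat) : {nnsfun R >-> R} :=
  scale_nnsfun (indic_nnsfun R (measurable_set1 (nth 0 s i))) (g0 (nth 0 s i)).
have hE i z : h i z = g (nth 0 s i) * (z == nth 0 s i)%:R.
  by rewrite [LHS](_ : _ = g (nth 0 s i) * \1_[set nth 0 s i] z) // indicE in_set1.
have hf z : ((sum_nnsfun h (size s) z)%:E <= f z)%E.
  apply: le_trans (gf z); rewrite lee_fin sum_nnsfunE.
  rewrite (eq_bigr (fun i : 'I_(size s) => g (nth 0 s i) * (z == nth 0 s i)%:R)); last first.
    by move=> i _; exact: hE.
  have [zs|zs] := boolP (z \in s); last first.
    rewrite big1 // => i _; rewrite (_ : (z == _) = false) ?mulr0 //.
    by apply/negbTE; apply: contra zs => /eqP ->; rewrite mem_nth.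
  have js : (index z s < size s)%N by rewrite index_mem.
  rewrite (bigD1 (Ordinal js)) //= nth_index // eqxx mulr1 big1 ?addr0 // => i.
  rewrite -val_eqE /= => ij; rewrite (_ : (z == _) = false) ?mulr0 //.
  apply/negbTE; apply: contra ij => /eqP ->.
  by rewrite index_uniq // undup_uniq.
rewrite ge0_integralTE; last by move=> z; apply: le_trans (gf z); rewrite lee_fin.
apply: ereal_sup_ge; exists (sintegral mu (sum_nnsfun h (size s))).
  by exists (sum_nnsfun h (size s)).
rewrite sintegral_sum_nnsfun.
have hi i : sintegral mu (h i) = ((g (nth 0 s i))%:E * mu [set nth 0%R s i])%E.
  rewrite -(sintegral_indic mu) //.
  exact: (sintegralrM mu (g (nth 0 s i)) (indic_nnsfun R (measurable_set1 (nth 0 s i)))).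
have -> : \sum_(k < K) m k * g (x k) =
  \sum_(i < size s) (\sum_(k < K | x k == nth 0 s i) m k) * g (nth 0 s i).
  have xs (k : 'I_K) : (index (x k) s < size s)%N.
    by rewrite index_mem mem_undup map_f // mem_iota /= add0n ltn_ord.
  rewrite (partition_big (fun k => Ordinal (xs k)) predT) //=.
  apply: eq_bigr => i _; rewrite mulr_suml; apply: eq_big => [k|k].
    rewrite -val_eqE /=; apply/eqP/eqP => [<-|->].
      by rewrite nth_index // -index_mem.
    by rewrite index_uniq // undup_uniq.
  by rewrite -val_eqE /= => /eqP <-; rewrite nth_index // -index_mem.
rewrite -sumEFin; apply: lee_sum => i _; rewrite hi mulrC EFinM.
by apply: lee_wpmul2l; rewrite ?lee_fin.
Qed.

Hypothesis mu01 : is_reservoir mu.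
Hypothesis x01 : forall k, 0 <= x k <= 1.

Lemma sintegral_off_reservoir (h : {nnsfun R >-> R}) :
  (forall z, 0 <= z <= 1 -> h z = 0) -> sintegral mu h = 0%E.
Proof.
move=> h0; rewrite sintegralE; apply: fsbig1 => z /= _.
have [->|z0] := eqVneq z 0; first by rewrite mul0e.
suff -> : mu (h @^-1` [set z]) = 0%E by rewrite mule0.
have mI : measurable [set` `[0%R, 1%R] : interval R] by exact: measurable_itv.
have I0 : mu (~` [set` `[0%R, 1%R]]) = 0%E by rewrite probability_setC // mu01 subee.
apply/eqP; rewrite eq_le measure_ge0 andbT -I0 le_measure ?inE //.
- exact: measurableC.
- by move=> y /= hy; rewrite in_itv /= => /h0 E; move: z0; rewrite -hy E eqxx.
Qed.

(** Means outside the unit interval may make [f] negative. Its negative part still has integral 0: a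
    simple function below it vanishes on the unit interval, which has full mass. *)
Lemma integral_atoms_ge (f : R -> \bar R) (g : R -> R) :
  (forall z, 0 <= z <= 1 -> 0 <= g z) ->
  (forall z, 0 <= z <= 1 -> ((g z)%:E <= f z)%E) ->
  ((\sum_(k < K) m k * g (x k))%:E <= \int[mu]_z f z)%E.
Proof.
move=> g0 gf.
pose g' z := if 0 <= z <= 1 then g z else 0.
have -> : \sum_(k < K) m k * g (x k) = \sum_(k < K) m k * g' (x k).
  by apply: eq_bigr => k _; rewrite /g' x01.
rewrite integralE.
have -> : (\int[mu]_z (f^\-)%E z = 0)%E.
  apply/eqP; rewrite eq_le integral_ge0 // andbT ge0_integralTE //.
  apply: ge_ereal_sup => _ [h /= hf <-]; rewrite sintegral_off_reservoir // => z z01.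
  apply/eqP; rewrite eq_le fun_ge0 andbT -lee_fin; apply: le_trans (hf z) _.
  by rewrite funenegE ge_max lexx andbT oppe_le0; apply: le_trans (gf z z01); rewrite lee_fin g0.
rewrite sube0; apply: nonneg_integral_atoms_ge => z; rewrite /g'.
  by case: ifP => // /g0.
by rewrite funeposE le_max; case: ifP => [/gf ->|_] //; rewrite lexx orbT.
Qed.

(** Counterpart of [iint] for the finite measure with masses [m k] at the points [x k], which need
    not be a probability. *)
Fixpoint atom_sum (M : nat) (f : (nat -> R) -> R) : R :=
  if M is M'.+1 then \sum_(k < K) m k * atom_sum M' (fun p => f (scons (x k) p))
  else f (fun=> 0).

Let scons01 z (p : nat -> R) : 0 <= z <= 1 -> (forall a, 0 <= p a <= 1) ->
  forall a, 0 <= scons z p a <= 1.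
Proof. by move=> z01 p01 [|a] /=. Qed.

Lemma atom_sum_ge0 M f :
  (forall p, (forall a, 0 <= p a <= 1) -> 0 <= f p) -> 0 <= atom_sum M f.
Proof.
elim: M f => [|M IH] f f0 /=; first by apply: f0 => a; rewrite lexx ler01.
apply: sumr_ge0 => k _; rewrite mulr_ge0 // IH // => p p01.
exact/f0/scons01.
Qed.

Lemma iint_ge_atom_sum M f :
  (forall p, (forall a, 0 <= p a <= 1) -> 0 <= f p) ->
  ((atom_sum M f)%:E <= iint mu M (fun p => (f p)%:E))%E.
Proof.
elim: M f => [|M IH] f f0 //=.
apply: (@integral_atoms_ge _ (fun z => atom_sum M (fun p => f (scons z p)))) => z z01.
  by apply: atom_sum_ge0 => p p01; apply/f0/scons01.
by apply: IH => p p01; apply/f0/scons01.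
Qed.

Lemma atom_sum_sum (I : finType) M (f : I -> (nat -> R) -> R) :
  atom_sum M (fun p => \sum_i f i p) = \sum_i atom_sum M (f i).
Proof.
elim: M f => [|M IH] f //=.
under eq_bigr => k _ do rewrite (IH (fun i p => f i (scons (x k) p))) mulr_sumr.
by rewrite exchange_big.
Qed.

Lemma atom_sumZ M (c : R) f : atom_sum M (fun p => c * f p) = c * atom_sum M f.
Proof.
elim: M f => [|M IH] f //=.
rewrite mulr_sumr; apply: eq_bigr => k _.
by rewrite (IH (fun p => f (scons (x k) p))) mulrCA.
Qed.

Lemma atom_sum_prod M (phi : nat -> R -> R) :
  atom_sum M (fun p => \prod_(a < M) phi a (p a)) =
  \prod_(a < M) \sum_(k < K) m k * phi a (x k).
Proof.
elim: M phi => [|M IH] phi /=; first by rewrite !big_ord0.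
rewrite big_ord_recl /= mulr_suml; apply: eq_bigr => k _.
have -> : (fun p => \prod_(a < M.+1) phi a (scons (x k) p a)) =
          (fun p => phi 0%N (x k) * \prod_(a < M) phi a.+1 (p a)).
  by apply/funext => p; rewrite big_ord_recl.
by rewrite atom_sumZ (IH (fun a => phi a.+1)) mulrA.
Qed.

(** Integrating out the means gives each arm the mixture likelihood of its own history. [H] bounds
    this mixture from below; for the output arm, the restriction to means below [beta] costs the
    factor [gamma]. The growth condition then handles the sum over runs. *)
Lemma det_err_ge (d : detAlg) (beta : R) (N : nat) (H : seq bool -> R) (e gamma : R) :
  0 <= e <= 1 -> 0 <= gamma -> (forall u, 0 <= H u) ->
  (forall u, (size u < N)%N -> e * H u <= H (rcons u true) + H (rcons u false)) ->
  (forall u, (size u <= N)%N -> H u <= \sum_(k < K) m k * likelihood (x k) u) ->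
  (forall u, (size u <= N)%N ->
     gamma * H u <= \sum_(k < K | x k < beta) m k * likelihood (x k) u) ->
  ((gamma * (e ^+ N * H [::] ^+ arm_bound d N))%:E <= det_err mu d beta N)%E.
Proof.
move=> e01 gamma0 H0 He HF HFb; set M := arm_bound d N.
(* The error indicator is attached to the factor of the output arm, so that the integrand is a
   product over arms. *)
pose phi (r : seq bool) (a : nat) (z : R) : R :=
  likelihood z (arm_history d a r) *
  (if a == output d r then if z < beta then 1 else 0 else 1).
have choose_lt (r : N.-tuple bool) t : (t < N)%N -> (choose d (take t r) < M)%N.
  move=> tN; rewrite /M /arm_bound ltnS.
  apply: leq_trans (leq_bigmax_cond r isT); apply: leq_trans (leq_maxr _ _).
  exact: (leq_bigmax_cond (Ordinal tN) isT).
have output_lt (r : N.-tuple bool) : (output d r < M)%N.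
  rewrite /M /arm_bound ltnS.
  by apply: leq_trans (leq_bigmax_cond r isT); apply: leq_maxl.
have errE p : err_given_means d beta N p = \sum_(r : N.-tuple bool) \prod_(a < M) phi r a (p a).
  apply: eq_bigr => r _; rewrite /phi big_split /=; congr (_ * _).
    rewrite -prod_bern_arms ?size_tuple //; last by move=> t; apply: choose_lt.
    by apply: eq_bigr => t _; rewrite (tnth_nth false).
  rewrite (bigD1 (Ordinal (output_lt r))) //= eqxx big1 ?mulr1 // => a.
  by rewrite -val_eqE /= => /negbTE ->.
have bern0 k b : 0 <= bern (x k) b.
  by have /andP[? ?] := x01 k; case: b; rewrite /bern ?subr_ge0.
have lik0 k u : 0 <= likelihood (x k) u by apply: prodr_ge0.
apply: (@le_trans _ _ (\sum_(r : N.-tuple bool) \prod_(a < M) \sum_(k < K) m k * phi r a (x k))%:E);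
  last first.
  under eq_bigr => r _ do rewrite -(atom_sum_prod M (phi r)).
  rewrite -(atom_sum_sum M (fun (r : N.-tuple bool) p => \prod_(a < M) phi r a (p a))).
  rewrite /det_err (_ : (fun p => \sum_r _) = err_given_means d beta N); last first.
    by apply/funext => p; rewrite errE.
  apply: iint_ge_atom_sum => p p01; apply: sumr_ge0 => r _; apply: mulr_ge0.
    apply: prodr_ge0 => t _; have /andP[? ?] := p01 (choose d (take t r)).
    by rewrite /bern; case: ifP; rewrite ?subr_ge0.
  by case: ifP.
rewrite lee_fin; apply: le_trans (ler_wpM2l gamma0 (sum_prod_arm_history_ge d M e01 H0 He)) _.
rewrite mulr_sumr; apply: ler_sum => r _.
rewrite (bigD1 (Ordinal (output_lt r))) //= [leRHS](bigD1 (Ordinal (output_lt r))) //= mulrA.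
have sz a : (size (arm_history d a r) <= N)%N.
  by apply: leq_trans (size_arm_history _ _ _) _; rewrite size_tuple.
apply: ler_pM.
- by rewrite mulr_ge0.
- exact: prodr_ge0.
- apply: le_trans (HFb _ (sz _)) _; rewrite big_mkcond /=; apply: ler_sum => k _.
  by rewrite /phi eqxx; case: ifP => _; rewrite ?mulr1 ?mulr0.
- apply: ler_prod => a; rewrite -val_eqE /= => /negbTE ao; rewrite H0 /=.
  apply: le_trans (HF _ (sz _)) _; apply: ler_sum => k _.
  by rewrite /phi ao mulr1.
Qed.

End Atoms.

(** * Confusing drifting arms with atoms of the reservoir *)

Section Confusion.
Variables (R : realType) (mu : probability R R) (lo hi p0 : R).
Hypothesis p00 : 0 < p0.
Hypothesis mean_bounds : forall th, lo <= th <= hi -> p0 <= angle_mean th <= 1 - p0.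
Variables (K : nat) (m th : nat -> R).
Hypotheses (m_gt0 : forall k, 0 < m k) (m_le1 : \sum_(k < K) m k <= 1).
Hypothesis th_bounds : forall k, lo <= th k <= hi.
Let x k := angle_mean (th k).
Hypothesis atoms : forall z, ((\sum_(k < K | x k == z) m k)%:E <= mu [set z])%E.
Hypothesis mu01 : is_reservoir mu.
Variables (beta : R) (klo : nat).
Hypotheses (lo_beta : angle_mean lo < beta) (kloK : (klo < K)%N) (th_klo : th klo = lo).
Variables (N : nat) (l sigma eps kappa kappa0 : R).
Hypotheses (l0 : 0 < l) (sigma0 : 0 <= sigma).
Hypotheses (eps0 : 0 <= eps) (eps2 : eps <= 2^-1).
Hypotheses (kap0 : 0 <= kappa) (kap00 : 0 <= kappa0).
Hypothesis speed : hi - lo <= sigma * ((1 - 2 * eps) * l).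
Let path k y := angle_path lo sigma (eps * l) (th k) y.
Let late (n : nat) : bool := eps * l < ln n%:R.
(* [J z] is an available arm type whose angle is close to [z]. *)
Variable J : R -> nat.
Hypothesis JK : forall z, (J z < K)%N.
Hypothesis J_lo : th (J lo) = lo.
Let j k (n : nat) := J (path k (ln n%:R - 1)).
Let q k (i : nat) := angle_mean (path k (ln i.+1%:R)).
Let w k n := m (j k n).
Let xc k n := x (j k n).
Let B k u := good_mass (q k) N kappa late (w k) (xc k) u.
Hypothesis good_nil : forall k, expR (- kappa0) <= B k [::].

Let x_bounds k : p0 <= x k <= 1 - p0.
Proof. exact: mean_bounds. Qed.

Let x01 k : 0 < x k < 1.
Proof. by have /andP[? ?] := x_bounds k; have p0_gt0 := p00; apply/andP; split; lra. Qed.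

Let q01 k i : 0 < q k i < 1.
Proof.
have /andP[h1 h2] : p0 <= q k i <= 1 - p0.
  by apply: mean_bounds; apply: angle_path_bounds.
by have p0_gt0 := p00; apply/andP; split; lra.
Qed.

(** The value 1 on the empty history matters: it enters to the power of the number of reachable
    arms, which is not bounded in terms of [N]. The loss from discarding bad sequences is therefore
    charged to the first pull. *)
Definition drift_measure k (u : seq bool) : R :=
  if u is [::] then 1 else expR (- (kappa * (size u)%:R)) * B k u.
Local Notation Hk := drift_measure.

Let lik_ge0 k u : 0 <= likelihood (x k) u.
Proof. by apply: likelihood_ge0; have /andP[? ?] := x01 k; apply/andP; split; lra. Qed.

Let B_ge0 k u : 0 <= B k u.
Proof. exact/good_mass_ge0/q01. Qed.

Let Hk_ge0 k u : 0 <= Hk k u.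
Proof. by case: u => [|b u] //; rewrite /Hk mulr_ge0 ?expR_ge0. Qed.

(** The good mass splits exactly, so a pull loses only the weight [expR (- kappa)]; the first pull
    also passes from 1 to the good mass, at least [expR (- kappa0)]. *)
Let Hk_growth k u : (size u < N)%N ->
  expR (- (kappa + kappa0)) * Hk k u <= Hk k (rcons u true) + Hk k (rcons u false).
Proof.
move=> uN.
have rconsE b : Hk k (rcons u b) =
    expR (- kappa) * (expR (- (kappa * (size u)%:R)) * B k (rcons u b)).
  rewrite mulrA -expRD.
  have -> : - kappa - kappa * (size u)%:R = - (kappa * (size (rcons u b))%:R).
    by rewrite size_rcons -natr1; ring.
  by case: u {uN} => [|c u].
rewrite !rconsE -!mulrDr -(good_mass_split _ _ _ _ _ uN) opprD expRD -mulrA ler_pM2l ?expR_gt0 //.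
case: u uN rconsE => [|c u] uN _.
  by rewrite /= mulr1 mulr0 oppr0 expR0 mul1r good_nil.
rewrite /Hk ler_piMl ?mulr_ge0 ?expR_ge0 //.
by rewrite expR_le1 oppr_le0.
Qed.

Let Hk_le_path k u : (size u <= N)%N -> Hk k u <= path_likelihood (q k) u.
Proof.
case: u => [|b u] uN; first by rewrite /Hk /path_likelihood big_ord0.
apply: le_trans (good_mass_le (q01 k) kappa late (w k) (xc k) uN).
by rewrite /= ler_piMl // expR_le1 oppr_le0 mulr_ge0.
Qed.

Let Hk_le_late k u : (size u <= N)%N -> late (size u) ->
  Hk k u <= m (j k (size u)) * likelihood (x (j k (size u))) u.
Proof.
case: u => [|b u] uN ul.
  by move: ul; rewrite /late ln0 // ltNge mulr_ge0 // ltW.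
apply: (good_mass_late (q01 k)) => // n; [exact: m_gt0|exact: x01].
Qed.

(** Up to logarithmic time [eps * l] the angle has not moved, so the path likelihood is the true
    likelihood of type [k]. *)
Let Hk_le_early k u : (size u <= N)%N -> ~~ late (size u) -> Hk k u <= likelihood (x k) u.
Proof.
move=> uN ul; apply: le_trans (Hk_le_path k uN) _.
rewrite /path_likelihood /likelihood (big_nth false) big_mkord.
rewrite le_eqVlt; apply/orP; left; apply/eqP; apply: eq_bigr => i _.
rewrite /q /path angle_path_early //; first by have /andP[] := th_bounds k.
move: ul; rewrite /late -leNgt; apply: le_trans.
by rewrite ler_ln ?posrE ?ltr0n ?ler_nat // (leq_trans _ (ltn_ord i)).
Qed.

Let Hsum u := \sum_(k < K) m k * Hk k u.
Let F u := \sum_(k < K) m k * likelihood (x k) u.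
Let Fb u := \sum_(k < K | x k < beta) m k * likelihood (x k) u.

Let avg_le u (c : R) : 0 <= c -> (forall k, Hk k u <= c) -> Hsum u <= c.
Proof.
move=> c0 Hc; apply: (@le_trans _ _ (\sum_(k < K) m k * c)).
  by apply: ler_sum => k _; rewrite ler_wpM2l // ltW.
by rewrite -mulr_suml ler_piMl.
Qed.

Let F_ge0 u : 0 <= F u.
Proof. by apply: sumr_ge0 => k _; rewrite mulr_ge0 // ltW. Qed.

Let Fb_ge0 u : 0 <= Fb u.
Proof. by apply: sumr_ge0 => k _; rewrite mulr_ge0 // ltW. Qed.

Let term_le_F i u : (i < K)%N -> m i * likelihood (x i) u <= F u.
Proof.
move=> iK; rewrite /F (bigD1 (Ordinal iK)) //= lerDl.
by apply: sumr_ge0 => k _; rewrite mulr_ge0 // ltW.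
Qed.

Let term_le_Fb i u : (i < K)%N -> th i = lo -> m i * likelihood (x i) u <= Fb u.
Proof.
move=> iK ilo; have xi : x i < beta by rewrite /x ilo.
rewrite /Fb (bigD1 (Ordinal iK)) //= lerDl.
by apply: sumr_ge0 => k _; rewrite mulr_ge0 // ltW.
Qed.

(** Early histories are compared type by type. For late ones each [Hk k u] is below a single term of
    [F u], and averaging with total weight at most 1 keeps this bound. *)
Let Hsum_le_F u : (size u <= N)%N -> Hsum u <= F u.
Proof.
move=> uN; have [ul|ul] := boolP (late (size u)); last first.
  by apply: ler_sum => k _; rewrite ler_wpM2l ?(ltW (m_gt0 k)) // Hk_le_early.
apply: avg_le => // k; apply: le_trans (Hk_le_late _ uN ul) _.
by apply: term_le_F; apply: JK.
Qed.

(** The mass of type [klo] times a lower bound for its likelihood of any history of at most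
    [expR (1 + (1 - eps) * l)] rewards, each of probability at least [p0]. For [l = ln N] that
    length is sublinear in [N]. *)
Definition confusion_const : R :=
  m klo * expR (ln p0 * expR (1 + (1 - eps) * l)).

Let p01 : p0 <= 1.
Proof. by have /andP[? ?] := x_bounds klo; have := p00; lra. Qed.

Let m_le k : (k < K)%N -> m k <= 1.
Proof.
move=> kK; apply: le_trans m_le1; rewrite (bigD1 (Ordinal kK)) //= lerDl.
by apply: sumr_ge0 => i _; rewrite ltW.
Qed.

Let const_le1 : confusion_const <= 1.
Proof.
rewrite mulr_ile1 ?expR_ge0 ?(ltW (m_gt0 _)) ?m_le //.
by rewrite expR_le1 mulr_le0_ge0 ?expR_ge0 // ln_le0.
Qed.

Let Hsum_le_Fb u : (size u <= N)%N -> confusion_const * Hsum u <= Fb u.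
Proof.
move=> uN; have c0 : 0 <= confusion_const by rewrite mulr_ge0 ?expR_ge0 ?(ltW (m_gt0 _)).
have H0 : 0 <= Hsum u by apply: sumr_ge0 => k _; rewrite mulr_ge0 // ltW.
(* After a long history the path is already at [lo] at time [ln n - 1], so the explaining type
   itself has mean below [beta]; a short history is paid for by [confusion_const]. *)
have [big|small] := leP (1 + (1 - eps) * l) (ln (size u)%:R).
  apply: (@le_trans _ _ (Hsum u)); first by rewrite ler_piMl.
  have ul : late (size u).
    rewrite /late; apply: lt_le_trans big.
    have : 0 <= (1 - 2 * eps) * l by rewrite mulr_ge0 ?(ltW l0) //; have := eps2; lra.
    by lra.
  apply: avg_le => // k; apply: le_trans (Hk_le_late _ uN ul) _.
  apply: term_le_Fb; first exact: JK.
  have th_hi : th k <= hi by have /andP[] := th_bounds k.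
  rewrite /j /path (angle_path_late sigma0 th_hi) ?J_lo //.
  by apply: le_trans speed _; rewrite ler_wpM2l //; lra.
apply: (@le_trans _ _ confusion_const).
  rewrite ler_piMr //; apply: avg_le => // k; apply: le_trans (Hk_le_path _ uN) _.
  exact/path_likelihood_le1/q01.
apply: le_trans (term_le_Fb _ kloK th_klo); rewrite ler_wpM2l ?(ltW (m_gt0 _)) //.
apply: (@le_trans _ _ (p0 ^+ size u)).
  rewrite -[p0 in leRHS]lnK ?posrE // -expRM_natr ler_expR.
  rewrite ler_wnM2l ?ln_le0 //.
  have [->|u0] := eqVneq (size u) 0%N; first exact: expR_ge0.
  by rewrite -[leLHS]lnK ?posrE ?ltr0n ?lt0n // ler_expR ltW.
rewrite /likelihood -(size_map (bern (x klo)) u) -(big_map (bern (x klo)) predT id) /=.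
have : all (fun y => p0 <= y) [seq bern (x klo) b | b <- u].
  apply/allP => y /mapP[b _ ->]; have /andP[? ?] := x_bounds klo.
  by case: b; rewrite /bern; lra.
elim: [seq _ | _ <- _] => [|y s IH] /=; first by rewrite big_nil expr0.
move=> /andP[py ps]; rewrite big_cons exprS ler_pM ?exprn_ge0 ?IH //; exact: ltW.
Qed.

Lemma det_err_confusion_ge d :
  ((confusion_const * (expR (- (kappa + kappa0)) ^+ N *
     (\sum_(k < K) m k) ^+ arm_bound d N))%:E <= det_err mu d beta N)%E.
Proof.
have -> : \sum_(k < K) m k = Hsum [::].
  by apply: eq_bigr => k _; rewrite /Hk mulr1.
apply: (det_err_ge (fun k => ltW (m_gt0 k)) atoms mu01).
- by move=> k; have /andP[? ?] := x01 k; apply/andP; split; apply: ltW.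
- by rewrite expR_ge0 expR_le1 oppr_le0 addr_ge0.
- by rewrite mulr_ge0 ?expR_ge0 ?(ltW (m_gt0 _)).
- by move=> u; apply: sumr_ge0 => k _; rewrite mulr_ge0 // ltW.
- move=> u uN; rewrite /Hsum mulr_sumr -big_split /=; apply: ler_sum => k _.
  by rewrite mulrCA -mulrDr ler_wpM2l ?(ltW (m_gt0 k)) ?Hk_growth.
- exact: Hsum_le_F.
- exact: Hsum_le_Fb.
Qed.

End Confusion.

(** * A Poisson reservoir on a dyadic grid *)

(** A named copy of [x] to which the structure of measurable function is attached; on [nat] every
    function is measurable. *)
Definition atom_map (R : realType) (x : nat -> R) : nat -> R := x.

HB.instance Definition _ (R : realType) (x : nat -> R) :=
  @isMeasurableFun.Build _ _ nat R (atom_map x) (fun _ _ _ => I).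

Section PoissonReservoir.
Variables (R : realType) (r : R) (x : nat -> R).
Hypothesis r0 : 0 < r.

(** Poisson weights are positive on every type, with [- ln] of the weight at most quadratic in the
    index, and type 0 has mass [expR (- r)], which can be tuned against [eta]. *)
Definition poisson_reservoir : probability R R :=
  distribution (poisson_prob r 0) (atom_map x).
Local Notation mu := poisson_reservoir.
Local Notation m := (poisson_pmf r).

Lemma poisson_reservoirE (A : set R) :
  mu A = (\esum_(k in x @^-1` A) (m k)%:E)%E.
Proof. by rewrite /mu /= /distribution /pushforward /= /poisson_prob r0. Qed.

Lemma poisson_pmf_gt0 k : 0 < m k.
Proof. by rewrite /poisson_pmf r0 !mulr_gt0 ?exprn_gt0 ?invr_gt0 ?expR_gt0 // ltr0n fact_gt0. Qed.

Lemma poisson_reservoir_atoms K z :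
  ((\sum_(k < K | x k == z) m k)%:E <= mu [set z])%E.
Proof.
rewrite poisson_reservoirE; apply: esum_ge.
exists [set` [seq k <- iota 0 K | x k == z]]; first split.
- by apply: finite_seq.
- by move=> k /=; rewrite mem_filter => /andP[/eqP].
rewrite -fsbig_seq ?filter_uniq ?iota_uniq // big_filter sumEFin lee_fin.
by rewrite -(big_mkord (fun k => x k == z) m) /index_iota subn0.
Qed.

Lemma poisson_reservoir_is_reservoir : (forall k, 0 <= x k <= 1) -> is_reservoir mu.
Proof.
move=> x01; rewrite /is_reservoir -(@probability_setT _ _ _ mu).
rewrite !poisson_reservoirE; congr (\esum_(k in _) _)%E.
by apply/seteqP; split => k //= _; rewrite in_itv /= x01.
Qed.

(** The top atom has mass at least [expR (- r) > eta], so [G] stays below [1 - eta] before it and is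
    1 from there on. *)
Lemma poisson_reservoir_Ginv (eta : R) : (forall k, 0 <= x k <= x 0%N) -> x 0%N <= 1 ->
  eta < expR (- r) -> 0 < eta -> Ginv mu (1 - eta) = x 0%N.
Proof.
move=> x01 x0 er eta0.
have G_ge tau : ((1 - eta)%:E <= G mu tau)%E = (x 0%N <= tau).
  have [tx|tx] := leP (x 0%N) tau.
    have -> : G mu tau = 1%E; last by rewrite lee_fin; lra.
    rewrite /G -(@probability_setT _ _ _ mu) !poisson_reservoirE; congr (\esum_(k in _) _)%E.
    apply/seteqP; split => k //= _; rewrite in_itv /=; have /andP[-> xk] := x01 k.
    by rewrite (le_trans xk tx).
  apply/negbTE; rewrite -ltNge /G.
  apply: (@le_lt_trans _ _ (mu (~` [set x 0%N]))).
    apply: le_measure; rewrite ?inE //; first exact: measurableC.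
    by move=> y /=; rewrite in_itv /= => /andP[_ yt] E; move: tx; rewrite -E ltNge yt.
  rewrite probability_setC //.
  apply: (@le_lt_trans _ _ (1 - (expR (- r))%:E)%E); last by rewrite -EFinB lte_fin; lra.
  apply: leeB => //; apply: le_trans (poisson_reservoir_atoms 1 (x 0%N)).
  by rewrite big_mkcond big_ord1 eqxx /= /poisson_pmf r0 expr0 fact0 invr1 !mul1r.
rewrite /Ginv (_ : [set tau | _] = [set` `[x 0%N, +oo[]); first by rewrite inf_itv.
by apply/funext => tau; rewrite /mkset G_ge in_itv /= andbT.
Qed.

Lemma poisson_pmf_ln_ge k (t : R) : k%:R <= t ->
  - ln (m k) <= r + t * `|ln r| + t ^+ 2.
Proof.
move=> kt; have f0 : 0 < k`!%:R :> R by rewrite ltr0n fact_gt0.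
rewrite /poisson_pmf r0 !lnM ?posrE ?mulr_gt0 ?exprn_gt0 ?invr_gt0 ?expR_gt0 //.
rewrite expRK lnV ?posrE // lnXn // -[ln r *+ k]mulr_natl.
have k0 : 0 <= k%:R :> R by [].
have t0 : 0 <= t by apply: le_trans kt.
have h1 : - (k%:R * ln r) <= t * `|ln r|.
  apply: (@le_trans _ _ (k%:R * `|ln r|)); last by rewrite ler_wpM2r.
  by rewrite -mulrN ler_wpM2l // -normrN ler_norm.
have h2 : ln k`!%:R <= t ^+ 2.
  apply: (@le_trans _ _ (k%:R * k%:R)); last by rewrite expr2 ler_pM.
  elim: (k) => [|i IH]; first by rewrite fact0 ln1 mulr0.
  rewrite factS natrM lnM ?posrE ?ltr0n ?fact_gt0 //.
  have : ln i.+1%:R <= i.+1%:R :> R by rewrite ltW // ln_sublinear // ltr0n.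
  have : 0 <= i%:R :> R by [].
  rewrite -natr1; nra.
lra.
Qed.

End PoissonReservoir.

Lemma poisson_pmf_sum_le1 (R : realType) (r : R) K : 0 < r ->
  \sum_(k < K) poisson_pmf r k <= 1.
Proof.
move=> r0; rewrite -lee_fin.
apply: le_trans (@probability_le1 _ _ _ (poisson_reservoir r (fun=> 0)) [set 0] _) => //.
apply: le_trans (poisson_reservoir_atoms (fun=> 0) r0 K 0).
by rewrite lee_fin [leRHS](eq_bigl xpredT) // => k; rewrite eqxx.
Qed.

(** Here [M] stands for the number of arms that a strategy can reach: truncating the reservoir to
    enough types costs at most a factor 2, however large [M] is. *)
Lemma poisson_pmf_sum_exp_ge (R : realType) (r : R) M : 0 < r ->
  exists K0, forall K, (K0 <= K)%N -> 2^-1 <= (\sum_(k < K) poisson_pmf r k) ^+ M.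
Proof.
move=> r0.
have m0 k : (0 <= (poisson_pmf r k)%:E)%E by rewrite lee_fin poisson_pmf_ge0.
have E : (\sum_(k <oo) (poisson_pmf r k)%:E = 1)%E.
  rewrite nneseries_esumT //.
  by transitivity (poisson_prob r 0 [set: nat]); [rewrite /poisson_prob r0|exact: probability_setT].
have cS : (\sum_(k < n) poisson_pmf r k) @[n --> \oo] --> (1 : R).
  have c : (\sum_(0 <= k < n) (poisson_pmf r k)%:E)%E @[n --> \oo] --> 1%E.
    by rewrite -E; apply: is_cvg_nneseries.
  have -> : (fun n => \sum_(k < n) poisson_pmf r k) =
            fine \o (fun n => \sum_(0 <= k < n) (poisson_pmf r k)%:E)%E.
    by apply/funext => n /=; rewrite sumEFin /= big_mkord.
  exact: fine_cvg c.
have := continuous_cvg _ (@exprn_continuous R M 1) cS; rewrite expr1n => cM.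
have half : 2^-1 < 1 :> R by lra.
have [K0 _ HK] := cvgr_ge 1 (cM _) _ half.
by exists K0 => K K0K; apply: HK.
Qed.

Section Grid.
Variables (R : realType) (lo hi : R).
Hypothesis lohi : lo < hi.

(* Type [2 ^ g + b] with [b < 2 ^ g] is the [b]-th point of the dyadic grid of
   mesh [2 ^ - g]; type 0 is the top angle. *)
Definition grid_angle (k : nat) : R :=
  if k == 0%N then hi
  else lo + (hi - lo) * (k%:R / 2 ^+ trunc_log 2 k - 1).

(** The cap serves [z = hi], whose rounded position [2 ^ g] would leave level [g]. *)
Definition grid_index (g : nat) (z : R) : nat :=
  (2 ^ g + minn (Num.truncn ((z - lo) / (hi - lo) * 2 ^+ g)) (2 ^ g).-1)%N.

Lemma grid_angle_bounds k : lo <= grid_angle k <= hi.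
Proof.
rewrite /grid_angle; have [_|k0] := eqVneq k 0%N; first by rewrite lexx (ltW lohi).
have P : 0 < 2 ^+ trunc_log 2 k :> R by rewrite exprn_gt0.
have h1 : 1 <= k%:R / 2 ^+ trunc_log 2 k :> R.
  by rewrite ler_pdivlMr // mul1r -natrX ler_nat trunc_logP // lt0n.
have h2 : k%:R / 2 ^+ trunc_log 2 k <= 2 :> R.
  by rewrite ler_pdivrMr // -exprS -natrX ler_nat ltnW // trunc_log_ltn.
have := lohi; nra.
Qed.

Lemma grid_index_lt g z : (grid_index g z < 2 ^ g.+1)%N.
Proof.
rewrite /grid_index expnS mul2n -addnn ltn_add2l.
by apply: leq_ltn_trans (geq_minr _ _) _; rewrite prednK // expn_gt0.
Qed.

Lemma grid_angle_index g z : grid_angle (grid_index g z) =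
  lo + (hi - lo) * ((minn (Num.truncn ((z - lo) / (hi - lo) * 2 ^+ g)) (2 ^ g).-1)%:R / 2 ^+ g).
Proof.
have h := grid_index_lt g z.
rewrite /grid_angle ifF; last by rewrite /grid_index addn_eq0 expn_eq0.
rewrite (_ : trunc_log 2 _ = g); last first.
  by apply: trunc_log_eq => //; rewrite leq_addr h.
rewrite /grid_index natrD natrX.
have P : 2 ^+ g != 0 :> R by rewrite expf_neq0 // pnatr_eq0.
by field.
Qed.

Lemma grid_index_lo g : grid_angle (grid_index g lo) = lo.
Proof. by rewrite grid_angle_index subrr !mul0r truncn0 min0n !mul0r mulr0 addr0. Qed.

Lemma grid_angle_near g z : lo <= z <= hi ->
  `|z - grid_angle (grid_index g z)| <= (hi - lo) / 2 ^+ g.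
Proof.
move=> /andP[zl zh]; rewrite grid_angle_index.
set y := (z - lo) / (hi - lo); have D0 : 0 < hi - lo by rewrite subr_gt0.
have P : 0 < 2 ^+ g :> R by rewrite exprn_gt0.
have y0 : 0 <= y by rewrite divr_ge0 ?(ltW D0) // subr_ge0.
have y1 : y <= 1 by rewrite ler_pdivrMr // mul1r lerD2r.
set t := y * 2 ^+ g; have t0 : 0 <= t by rewrite mulr_ge0 // ltW.
set b := minn _ _.
have tb : `|t - b%:R| <= 1.
  have /andP[t1 t2] := truncn_itv t0.
  rewrite /b; have [c|c] := leqP (Num.truncn t) (2 ^ g).-1.
    by rewrite -natr1 in t2; rewrite ler_norml; apply/andP; split; lra.
  have tg : t <= 2 ^+ g by rewrite ler_piMl // ltW.
  have gt : (2 ^ g)%:R <= t.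
    apply: le_trans t1; rewrite ler_nat; apply: leq_trans c.
    by rewrite prednK // expn_gt0.
  rewrite natrX in gt.
  have -> : (2 ^ g).-1%:R = 2 ^+ g - 1 :> R.
    by rewrite -subn1 natrB ?expn_gt0 // natrX.
  by rewrite ler_norml; apply/andP; split; lra.
have -> : z - (lo + (hi - lo) * (b%:R / 2 ^+ g)) = (t - b%:R) * ((hi - lo) / 2 ^+ g).
  by rewrite /t /y; field; rewrite !gt_eqF.
by rewrite normrM [X in _ * X]ger0_norm ?ler_piMl ?divr_ge0 // ltW.
Qed.

End Grid.

(** * The lower bound for the Poisson reservoir *)

Section Auxiliary.
Variable R : realType.

Lemma angle_mean_lt (a b : R) : 0 <= a -> a < b -> b <= pi ->
  angle_mean a < angle_mean b.
Proof.
move=> a0 ab bp; rewrite /angle_mean ltr_pM2r // ltrD2l ltrN2.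
by rewrite ltr_cos // in_itv /= ?a0 ?bp ?(le_trans a0 (ltW ab)) ?(le_trans (ltW ab) bp).
Qed.

Lemma angle_mean_le (a b : R) : 0 <= a -> a <= b -> b <= pi ->
  angle_mean a <= angle_mean b.
Proof.
move=> a0; rewrite le_eqVlt => /predU1P[->//|ab] bp.
exact/ltW/angle_mean_lt.
Qed.

Lemma angle_mean_acos (p : R) : 0 < p < 1 -> angle_mean (acos (1 - 2 * p)) = p.
Proof.
move=> /andP[p0 p1]; rewrite /angle_mean acosK ?in_itv /=; first by field.
by apply/andP; split; lra.
Qed.

Lemma limn_einf_le (u : (\bar R)^nat) (c : \bar R) (n0 : nat) :
  (forall n, (n0 <= n)%N -> (u n <= c)%E) -> (limn_einf u <= c)%E.
Proof.
move=> uc; rewrite limn_einf_lim; apply: lime_le; first exact: is_cvg_einfs.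
exists n0 => // n /= n0n; apply: le_trans (uc n n0n).
by apply: ereal_inf_lbound; exists n => //=; apply: leqnn.
Qed.

Lemma rand_err_ge (mu : probability R R) (w : detAlg -> R) (beta c : R) N :
  rand_alg w -> 0 < c -> (forall d, (c%:E <= det_err mu d beta N)%E) ->
  (c%:E <= rand_err mu w beta N)%E.
Proof.
move=> [w0 w1] c0 hd.
(* With [c] moved to the other side, 1 becomes the sum of the weights, a supremum of finite sums
   that are compared one at a time. *)
suff : (1 <= c^-1%:E * rand_err mu w beta N)%E.
  move=> h; have : (c%:E * 1 <= c%:E * (c^-1%:E * rand_err mu w beta N))%E.
    by apply: lee_wpmul2l => //; rewrite lee_fin ltW.
  by rewrite mule1 muleA -EFinM divff ?gt_eqF // mul1e.
rewrite -w1; apply: ge_ereal_sup => _ [F Ffs <-]; have [Ffin _] := Ffs.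
apply: (@le_trans _ _ (c^-1%:E * \sum_(d \in F) ((w d)%:E * det_err mu d beta N))%E).
  rewrite !fsbig_finite //= ge0_sume_distrr; last first.
    move=> d _; apply: mule_ge0; first by rewrite lee_fin.
    by apply: le_trans (hd d); rewrite lee_fin ltW.
  apply: lee_sum => d _; apply: (@le_trans _ _ (c^-1%:E * ((w d)%:E * c%:E))%E).
    by rewrite -!EFinM lee_fin mulrCA mulVf ?mulr1 // gt_eqF.
  apply: lee_wpmul2l; first by rewrite lee_fin invr_ge0 ltW.
  by apply: lee_wpmul2l; rewrite ?lee_fin.
apply: lee_wpmul2l; first by rewrite lee_fin invr_ge0 ltW.
by apply: ereal_sup_ubound; exists F.
Qed.

Lemma rate_le (P : \bar R) (c rho : R) N : (0 < N)%N -> 0 < c -> 0 <= rho -> (c%:E <= P)%E ->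
  - ln c * ln N%:R ^+ 2 / N%:R <= rho -> (rate P N <= rho%:E)%E.
Proof.
move=> N0 c0 rho0 cP h.
have P0 : P != 0%E by rewrite gt_eqF // (lt_le_trans _ cP) // lte_fin.
rewrite /rate (negbTE P0) lee_fin.
(* For an infinite [P] the default values [fine +oo = 0] and [ln 0 = 0] give rate 0. *)
case: P cP P0 => [p| |] //; rewrite ?lee_fin => cP _ /=; last first.
  by rewrite ln0 // oppr0 !mul0r.
apply: le_trans h; rewrite ler_wpM2r ?invr_ge0 // ler_wpM2r ?sqr_ge0 // lerN2.
by rewrite ler_ln ?posrE // (lt_le_trans c0).
Qed.


(** [omega] is the margin of [lo] below the angle of [beta], and the drift uses a fraction
    [1 - 2 * e] of the logarithmic time; as both margins vanish, the cost tends to [D ^+ 2 / 2]. *)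
Lemma exists_parameters (D nu lo0 : R) : 0 < D -> 0 < nu <= 1 -> 0 < lo0 ->
  exists omega, [/\ 0 < omega, omega < lo0 &
   exists e, [/\ 0 < e, e <= 16^-1 &
    let sig0 := (D + omega) / (1 - 2 * e) in
    sig0 ^+ 2 / 2 * (1 + 5 * e) <= D ^+ 2 / 2 + 2 * nu]].
Proof.
move=> D0 /andP[nu0 nu1] lo00.
pose omega := Num.min (lo0 / 2) (nu / (D + 1)).
have o0 : 0 < omega by rewrite lt_min !divr_gt0 //; lra.
have o1 : omega <= lo0 / 2 by rewrite ge_min lexx.
have o2 : omega * (D + 1) <= nu.
  by rewrite -ler_pdivlMr ?ge_min ?lexx ?orbT //; lra.
exists omega; split => //; first by lra.
pose A := (D + omega) ^+ 2 / 2.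
have A0 : 0 < A by rewrite divr_gt0 // exprn_gt0 // addr_gt0.
have A1 : A <= D ^+ 2 / 2 + nu.
  have : omega <= 1 by nra.
  by rewrite /A; nra.
pose tau := nu / (A + 1).
have t0 : 0 < tau by rewrite divr_gt0 //; lra.
have t1 : tau * (A + 1) = nu by rewrite /tau divfK // gt_eqF //; lra.
have t2 : tau <= 1 by nra.
(* The divisor 16 yields [(1 + 5 * e) / (1 - 2 * e) ^+ 2 <= 1 + tau], and [tau] was chosen so that
   [A * tau <= nu]. *)
exists (tau / 16); split; [lra|lra|].
set e := tau / 16; have e0 : 0 < e by rewrite /e; lra.
have e1 : e <= 16^-1 by rewrite /e; lra.
have te : tau = 16 * e by rewrite /e; field.
rewrite /= expr_div_n.
have P : 0 < (1 - 2 * e) ^+ 2 by rewrite exprn_gt0 //; lra.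
have -> : (D + omega) ^+ 2 / (1 - 2 * e) ^+ 2 / 2 * (1 + 5 * e) =
   A * ((1 + 5 * e) / (1 - 2 * e) ^+ 2).
  by rewrite /A; field; lra.
apply: (@le_trans _ _ (A * (1 + tau))); last by nra.
rewrite ler_wpM2l ?(ltW A0) // ler_pdivrMr // te.
have : e * e <= e * 16^-1 by rewrite ler_wpM2l // ltW.
rewrite expr2; nra.
Qed.

(** After scaling, the overhead is of order [l ^+ 4 / expR (eps * l)], beaten by
    [(eps * l / 5) ^+ 5 <= expR (eps * l)]. *)
Lemma negligible_terms (eps nu Cw c0 : R) : 0 < eps -> eps < 1 -> 0 < nu -> 0 <= Cw -> 0 <= c0 ->
  exists l0, forall l, l0 <= l -> 1 <= l ->
    (Cw * l ^+ 2 + c0 * expR (1 + (1 - eps) * l) + 1) * l ^+ 2 / expR l <= nu.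
Proof.
move=> e0 e1 nu0 Cw0 c00.
pose Q := Cw + c0 * expR 1 + 1.
have Q0 : 0 < Q by rewrite /Q ltr_wpDl // addr_ge0 // mulr_ge0 ?expR_ge0.
exists (Q / (nu * (eps / 5) ^+ 5)) => l hl l1.
have l0 : 0 < l by lra.
have E : expR ((1 - eps) * l) = expR l / expR (eps * l).
  by rewrite -expRB; congr expR; ring.
have big1 : expR ((1 - eps) * l) >= 1.
  by rewrite -[leLHS]expR0 ler_expR mulr_ge0 //; lra.
have l2 : 1 <= l ^+ 2 by rewrite exprn_ege1.
apply: (@le_trans _ _ (Q * l ^+ 4 / expR (eps * l))).
  have -> : Q * l ^+ 4 / expR (eps * l) = Q * l ^+ 2 * expR ((1 - eps) * l) * l ^+ 2 / expR l.
    by rewrite E; field; rewrite !gt_eqF ?expR_gt0.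
  rewrite ler_wpM2r ?invr_ge0 ?expR_ge0 // ler_wpM2r ?sqr_ge0 // expRD.
  set X := expR ((1 - eps) * l) in big1 *.
  have h1 : Cw * l ^+ 2 <= Cw * l ^+ 2 * X by rewrite ler_peMr // mulr_ge0 // sqr_ge0.
  have h2 : c0 * (expR 1 * X) <= c0 * expR 1 * l ^+ 2 * X.
    have -> : c0 * expR 1 * l ^+ 2 * X = c0 * (expR 1 * X) * l ^+ 2 by ring.
    by rewrite ler_peMr // !mulr_ge0 ?expR_ge0 //; lra.
  have h3 : 1 <= l ^+ 2 * X by rewrite mulr_ege1.
  rewrite /Q; lra.
rewrite ler_pdivrMr ?expR_gt0 //.
have e5 : 0 < nu * (eps / 5) ^+ 5 by rewrite mulr_gt0 // exprn_gt0 // divr_gt0.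
apply: (@le_trans _ _ (nu * (eps * l / 5) ^+ 5)).
  have -> : nu * (eps * l / 5) ^+ 5 = l * (nu * (eps / 5) ^+ 5) * l ^+ 4 by field.
  by rewrite ler_wpM2r ?exprn_ge0 ?(ltW l0) // -ler_pdivrMr.
rewrite ler_wpM2l ?(ltW nu0) //.
have -> : expR (eps * l) = expR (eps * l / 5) ^+ 5.
  by rewrite -expRM_natl; congr expR; field.
rewrite lerXn2r ?nnegrE ?expR_ge0 ?divr_ge0 ?mulr_ge0 ?(ltW e0) ?(ltW l0) //.
by apply: le_trans (expR_ge1Dx _); lra.
Qed.

(** Take [2 ^ g] between [l / e] and a constant multiple of it: the mesh is fine enough for the
    drift speed, while indices stay of order [l] and their masses cost order [l ^+ 2]. *)
Lemma grid_level (lo hi e l r : R) : lo < hi -> 0 < e <= 1 -> 1 <= l -> 0 < r ->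
  exists g, [/\ forall z, - ln (poisson_pmf r (grid_index lo hi g z)) <=
      (r + 8 / e * `|ln r| + (8 / e) ^+ 2) * l ^+ 2 &
    forall z, lo <= z <= hi ->
      `|z - grid_angle lo hi (grid_index lo hi g z)| <= (hi - lo) / l * e].
Proof.
move=> lohi /andP[e0 e1] lge1 r0.
have l0 : 0 < l by lra.
have le0 : 0 <= l / e by rewrite divr_ge0 // ltW.
have /andP[Y1 Y2] := truncn_itv le0.
set Y := (Num.truncn (l / e)).+1 in Y2.
exists (trunc_log 2 Y).+1; set g := (trunc_log 2 Y).+1; split => z.
  have Jt : (grid_index lo hi g z)%:R <= 8 / e * l.
    apply: (@le_trans _ _ (4 * Y)%:R).
      rewrite ler_nat; apply: leq_trans (ltnW (grid_index_lt lo hi g z)) _.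
      rewrite expnS -[4%N]/(2 * 2)%N -mulnA leq_mul2l /=.
      by rewrite expnS leq_mul2l /= trunc_logP.
    rewrite natrM /Y -natr1.
    have : 1 <= l / e by rewrite ler_pdivlMr // mul1r; lra.
    have -> : 8 / e * l = 8 * (l / e) by field; rewrite gt_eqF.
    by lra.
  apply: le_trans (poisson_pmf_ln_ge r0 Jt) _.
  have l2 : 1 <= l ^+ 2 by rewrite exprn_ege1.
  have ll2 : l <= l ^+ 2 by rewrite expr2 ler_peMl // ltW.
  have e8 : 0 <= 8 / e by rewrite divr_ge0 // ltW.
  have h2 : 8 / e * l * `|ln r| <= 8 / e * `|ln r| * l ^+ 2.
    by rewrite mulrAC ler_wpM2l // mulr_ge0.
  have -> : (8 / e * l) ^+ 2 = (8 / e) ^+ 2 * l ^+ 2 by rewrite exprMn.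
  rewrite [leRHS]mulrDl lerD2r [leRHS]mulrDl; apply: lerD h2.
  by rewrite ler_peMr // ltW.
move=> hz; apply: le_trans (grid_angle_near lohi g hz) _.
have P : 0 < 2 ^+ g :> R by rewrite exprn_gt0.
have D0 : 0 < hi - lo by rewrite subr_gt0.
have lg : l / e <= 2 ^+ g.
  rewrite -natrX; apply: le_trans (ltW Y2) _.
  by rewrite ler_nat ltnW // trunc_log_ltn.
rewrite ler_pdivrMr // -[leLHS](_ : (hi - lo) / l * e * (l / e) = _); last first.
  by field; rewrite !gt_eqF.
by rewrite ler_wpM2l // mulr_ge0 ?divr_ge0 // ltW.
Qed.

End Auxiliary.

(** * Exponential cost of an error, uniformly over strategies *)

Section PoissonConfusion.
Variables (R : realType) (lo hi p0 e s kap nu sig0 r beta : R).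
Hypotheses (lo0 : 0 <= lo) (lohi : lo < hi) (hipi : hi <= pi) (p00 : 0 < p0).
Hypothesis mean_bounds : forall th, lo <= th <= hi -> p0 <= angle_mean th <= 1 - p0.
Hypotheses (e0 : 0 < e) (e2 : e <= 2^-1).
Hypotheses (s0 : 0 < s) (sp : s <= p0 / 2) (nu0 : 0 < nu) (nu1 : nu <= 1).
Hypotheses (sig00 : 0 <= sig0) (sigE : hi - lo = sig0 * (1 - 2 * e)).
Hypothesis slack :
  sig0 ^+ 2 / 2 * (1 + 5 * e) + 6 * s * sig0 ^+ 2 / p0 ^+ 2 <= kap - 2 * nu.
Hypotheses (r0 : 0 < r) (lo_beta : angle_mean lo < beta).

Let m := poisson_pmf r.
Let th := grid_angle lo hi.
Let x k := angle_mean (th k).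
Let mu := poisson_reservoir r x.
Hypothesis res : is_reservoir mu.

Let Cw := r + 8 / e * `|ln r| + (8 / e) ^+ 2.

Let Cw0 : 0 <= Cw.
Proof.
have e8 : 0 <= 8 / e by rewrite divr_ge0 // ltW.
by apply: addr_ge0 (sqr_ge0 _); apply: addr_ge0 (ltW r0) _; exact: mulr_ge0.
Qed.

Let e1 : e <= 1.
Proof. by have := e2; lra. Qed.

Let kap0 : 0 <= kap.
Proof.
have h1 : 0 <= sig0 ^+ 2 / 2 * (1 + 5 * e).
  by rewrite mulr_ge0 ?divr_ge0 ?sqr_ge0 // addr_ge0 // mulr_ge0 // ltW.
have h2 : 0 <= 6 * s * sig0 ^+ 2 / p0 ^+ 2.
  by rewrite divr_ge0 ?mulr_ge0 ?sqr_ge0 // ltW.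
by have := slack; have := nu0; lra.
Qed.

(** The first two terms pay for the output arm, the third for the [N] pulls, and the last for
    truncating the reservoir. *)
Lemma poisson_det_err_ge : exists l0, forall (N : nat) (l : R), l = ln N%:R ->
  (0 < N)%N -> l0 <= l -> 1 <= l ->
  exists2 c, 0 < c &
    - ln c <= Cw * l ^+ 2 - ln p0 * expR (1 + (1 - e) * l)
              + (kap + nu) / l ^+ 2 * N%:R + 1 /\
    forall d, (c%:E <= det_err mu d beta N)%E.
Proof.
have [l1 late] := late_sum_le lo0 hipi p00 mean_bounds e0 e0 e1 s0 sp nu0 nu1
   sig00 Cw0 slack.
exists l1 => N l lE N0 l11 lge1.
have l0 : 0 < l by apply: lt_le_trans lge1.
have e01 : 0 < e <= 1 by rewrite e0 e1.
have [g [mJ nearJ]] := grid_level lohi e01 lge1 r0.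
pose J := grid_index lo hi g.
pose sigma := sig0 / l; have sigma0 : 0 <= sigma by rewrite divr_ge0 // ltW.
have near z : lo <= z <= hi -> `|z - th (J z)| <= sigma * e.
  move=> hz; apply: le_trans (nearJ z hz) _.
  rewrite ler_wpM2r ?(ltW e0) // ler_wpM2r ?invr_ge0 ?(ltW l0) //.
  by rewrite sigE ler_piMr // lerBlDr lerDl mulr_ge0 // ltW.
pose kappa := kap / l ^+ 2; pose kappa0 := nu / l ^+ 2.
have lsq : 0 < l ^+ 2 by rewrite exprn_gt0.
have kappa_ge0 : 0 <= kappa by rewrite divr_ge0 // ltW.
have kappa0_ge0 : 0 <= kappa0 by rewrite divr_ge0 // ltW.
have th_bounds k : lo <= th k <= hi by apply: grid_angle_bounds.
have m_gt0 k : 0 < m k by apply: poisson_pmf_gt0.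
pose path k y := angle_path lo sigma (e * l) (th k) y.
pose q k (i : nat) := angle_mean (path k (ln i.+1%:R)).
pose w k (n : nat) := m (J (path k (ln n%:R - 1))).
pose xc k (n : nat) := x (J (path k (ln n%:R - 1))).
have path_bounds k y : lo <= path k y <= hi by apply: angle_path_bounds.
have in01 p : p0 <= p <= 1 - p0 -> 0 < p < 1.
  move=> /andP[h1 h2]; rewrite (lt_le_trans p00 h1) (le_lt_trans h2) //.
  by rewrite ltrBlDr ltrDl.
have good_nil k : expR (- kappa0) <=
   good_mass (q k) N kappa (fun n => e * l < ln n%:R) (w k) (xc k) [::].
  have q01 i : 0 < q k i < 1 by apply/in01/mean_bounds/path_bounds.
  have w0 n : 0 < w k n by exact: m_gt0.
  have xc01 n : 0 < xc k n < 1 by apply/in01/mean_bounds/th_bounds.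
  apply: le_trans (good_mass_nil q01 N kappa _ w0 xc01 s0).
  exact: (late N l lE l11 (th k) (fun n => th (J (path k (ln n%:R - 1)))) (w k) (th_bounds k)
    (fun n => th_bounds _) (fun n => conj (w0 n) (mJ _)) (fun n => near _ (path_bounds k _))).
exists (m (J lo) * expR (ln p0 * expR (1 + (1 - e) * l)) *
   (expR (- (kappa + kappa0)) ^+ N * 2^-1)).
  by rewrite !mulr_gt0 ?exprn_gt0 ?expR_gt0.
split.
  rewrite !lnM ?posrE ?mulr_gt0 ?exprn_gt0 ?expR_gt0 ?invr_gt0 //.
  rewrite lnXn ?expR_gt0 // !expRK lnV ?posrE // -[_ *+ N]mulr_natr.
  have ln2 : ln 2 <= 1 :> R.
    have := @le_ln1Dx R 1; rewrite (_ : 1 + 1 = 2); last by ring.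
    by apply; lra.
  have -> : (kap + nu) / l ^+ 2 * N%:R = (kappa + kappa0) * N%:R by rewrite -mulrDl.
  have := mJ lo; rewrite -/Cw -/J -/m.
  set a1 := ln (m _); set a2 := Cw * _; set a3 := ln p0 * _; set a4 := (kappa + _).
  rewrite mulNr; set a5 := a4 * _; lra.
move=> d.
(* [K] may depend on the strategy since [c] does not involve it; it also exceeds every index
   returned by [J]. *)
have [K0 hK0] := poisson_pmf_sum_exp_ge (arm_bound d N) r0.
pose K := maxn K0 (2 ^ g.+1).
have JK z : (J z < K)%N by apply: leq_trans (grid_index_lt lo hi g z) (leq_maxr _ _).
have speed : hi - lo <= sigma * ((1 - 2 * e) * l).
  rewrite sigE le_eqVlt; apply/orP; left; apply/eqP.
  by rewrite /sigma -mulrA [_^-1 * _]mulrCA mulVf ?mulr1 // gt_eqF.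
have := @det_err_confusion_ge R mu lo hi p0 p00
  mean_bounds K m th m_gt0 (poisson_pmf_sum_le1 K r0) th_bounds
  (poisson_reservoir_atoms x r0 K) res beta (J lo) lo_beta (JK lo)
  (grid_index_lo lo hi g) N l sigma e kappa kappa0 l0 sigma0 (ltW e0) e2 kappa_ge0
  kappa0_ge0 speed J JK (grid_index_lo lo hi g) good_nil d.
apply: le_trans; rewrite lee_fin /confusion_const.
rewrite ler_wpM2l ?mulr_ge0 ?expR_ge0 ?(ltW (m_gt0 _)) //.
by rewrite ler_wpM2l ?exprn_ge0 ?expR_ge0 // hK0 // leq_maxl.
Qed.

Hypothesis p01 : p0 <= 1.

(** With [l = ln N], the pulls contribute exactly [kap + nu] to the rate, and all other terms at
    most [nu] for large [N]. *)
Lemma poisson_limn_einf_le (A : nat -> detAlg -> R) : (forall N, rand_alg (A N)) ->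
  (limn_einf (fun N => rate (rand_err mu (A N) beta N) N) <= (kap + 2 * nu)%:E)%E.
Proof.
move=> hA; have [l1 derr] := poisson_det_err_ge.
have lnp0 : 0 <= - ln p0 by rewrite oppr_ge0 ln_le0.
have elt1 : e < 1 by have := e2; lra.
have [l2 neg] := negligible_terms e0 elt1 nu0 Cw0 lnp0.
pose L := `|l1| + `|l2| + 1.
apply: (@limn_einf_le _ _ _ (Num.bound (expR L)).+1) => N hN.
have N0 : (0 < N)%N by apply: leq_trans hN.
have NR0 : 0 < N%:R :> R by rewrite ltr0n.
pose l : R := ln N%:R.
have El : expR l = N%:R by rewrite lnK ?posrE.
have lL : L <= l.
  rewrite -ler_expR El; apply: le_trans (_ : (Num.bound (expR L))%:R <= _).
    by rewrite ltW // archi_boundP // expR_ge0.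
  by rewrite ler_nat ltnW.
have [n1 n2] := (normr_ge0 l1, normr_ge0 l2).
have l11 : l1 <= l.
  by apply: le_trans (ler_norm _) (le_trans _ lL); rewrite /L -addrA lerDl addr_ge0.
have l22 : l2 <= l.
  by apply: le_trans (ler_norm _) (le_trans _ lL); rewrite /L addrAC lerDr addr_ge0.
have lge1 : 1 <= l by apply: le_trans lL; rewrite /L lerDr addr_ge0.
have [c c0 [lnc hc]] := derr N l erefl N0 l11 lge1.
have nu_ge0 := ltW nu0.
apply: (@rate_le _ _ c) => //; first by rewrite addr_ge0 // mulr_ge0.
  exact: rand_err_ge.
rewrite -/l; have lsq : 0 < l ^+ 2 by rewrite exprn_gt0 // (lt_le_trans _ lge1).
apply: (@le_trans _ _ ((Cw * l ^+ 2 - ln p0 * expR (1 + (1 - e) * l)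
              + (kap + nu) / l ^+ 2 * N%:R + 1) * l ^+ 2 / N%:R)).
  by rewrite ler_wpM2r ?invr_ge0 ?ler0n // ler_wpM2r ?(ltW lsq).
have := neg l l22 lge1; rewrite El mulNr.
set a := Cw * l ^+ 2; set b := ln p0 * _ => hneg.
have -> : (a - b + (kap + nu) / l ^+ 2 * N%:R + 1) * l ^+ 2 / N%:R =
          (kap + nu) + (a - b + 1) * l ^+ 2 / N%:R.
  by field; rewrite !gt_eqF // (lt_le_trans _ lge1).
rewrite (_ : kap + 2 * nu = kap + nu + nu); last by ring.
by rewrite lerD2l.
Qed.

End PoissonConfusion.

(** * Choice of the reservoir and of the drift parameters *)

Theorem theorem1p8 (R : realType) (lambda eta alpha beta : R) :
  0 < lambda < 1 -> 0 < eta < 1 -> 0 < beta -> beta < alpha -> alpha < 1 ->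
  exists mu : probability R R,
    is_reservoir mu /\ Ginv mu (1 - eta) = alpha /\
    forall A : nat -> detAlg -> R,
      (forall N, rand_alg (A N)) ->
      (limn_einf (fun N => rate (rand_err mu (A N) beta N) N)
         <= (c_ab alpha beta + lambda)%:E)%E.
Proof.
move=> /andP[lam0 lam1] /andP[eta0 eta1] beta0 ba alpha1.
pose tha := acos (1 - 2 * alpha); pose thb := acos (1 - 2 * beta).
have ma : angle_mean tha = alpha by apply: angle_mean_acos; apply/andP; split; lra.
have mb : angle_mean thb = beta by apply: angle_mean_acos; apply/andP; split; lra.
have thb0 : 0 < thb by apply: acos_gt0; apply/andP; split; lra.
have tha0 : 0 <= tha by apply: acos_ge0; apply/andP; split; lra.
have thapi : tha <= pi by apply: acos_lepi; apply/andP; split; lra.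
have thbpi : thb <= pi by apply: acos_lepi; apply/andP; split; lra.
have thab : thb < tha.
  rewrite ltNge; apply/negP => h.
  by have := angle_mean_le tha0 h thbpi; rewrite ma mb leNgt ba.
pose D := tha - thb; have D0 : 0 < D by rewrite subr_gt0.
have cE : c_ab alpha beta = D ^+ 2 / 2 by [].
(* The final bound is [D ^+ 2 / 2 + 7 * nu], below [c_ab alpha beta + lambda]. *)
pose nu := lambda / 8; have nu0 : 0 < nu by rewrite /nu; lra.
have nu1 : nu <= 1 by rewrite /nu; lra.
have nu01 : 0 < nu <= 1 by rewrite nu0.
have [omega [om0 omb [e [e0 e16]]]] := exists_parameters D0 nu01 thb0.
set sig0 := (D + omega) / (1 - 2 * e) => sig_le.
pose lo := thb - omega; pose hi := tha.
have lo0 : 0 < lo by rewrite subr_gt0.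
have lothb : lo < thb by rewrite /lo; lra.
have lohi : lo < hi by rewrite /hi; lra.
have sig00 : 0 < sig0 by rewrite divr_gt0 //; lra.
have sigE : hi - lo = sig0 * (1 - 2 * e).
  by rewrite /sig0 /hi /lo /D; field; rewrite gt_eqF //; lra.
move: sig0 sig_le sig00 sigE => sig0 /= sig_le sig00 sigE.
have x_lo0 : 0 < angle_mean lo.
  have := angle_mean_lt (lexx 0) lo0 (ltW (lt_le_trans lohi thapi)).
  by rewrite {1}/angle_mean cos0 subrr mul0r.
have x_lo_beta : angle_mean lo < beta by rewrite -mb; apply: angle_mean_lt => //; apply: ltW.
pose p0 := Num.min (angle_mean lo) (1 - alpha).
have p00 : 0 < p0 by rewrite lt_min x_lo0 subr_gt0.
have p0lo : p0 <= angle_mean lo by rewrite ge_min lexx.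
have p0al : p0 <= 1 - alpha by rewrite ge_min lexx orbT.
have mean_bounds th : lo <= th <= hi -> p0 <= angle_mean th <= 1 - p0.
  move=> /andP[h1 h2].
  have l1 := angle_mean_le (ltW lo0) h1 (le_trans h2 thapi).
  have l2 := angle_mean_le (le_trans (ltW lo0) h1) h2 thapi.
  by rewrite ma in l2; apply/andP; split; lra.
have p01 : p0 < 1 by lra.
(* The first bound serves the moment estimate; the second makes the second-order Chernoff term at
   most [nu]. *)
pose s := Num.min (p0 / 2) (nu * p0 ^+ 2 / (6 * sig0 ^+ 2)).
have s0 : 0 < s.
  rewrite lt_min divr_gt0 //=; apply: divr_gt0; apply: mulr_gt0 => //; exact: exprn_gt0.
have sp : s <= p0 / 2 by rewrite ge_min lexx.
have s_nu : 6 * s * sig0 ^+ 2 / p0 ^+ 2 <= nu.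
  have : s <= nu * p0 ^+ 2 / (6 * sig0 ^+ 2) by rewrite ge_min lexx orbT.
  rewrite ler_pdivlMr ?mulr_gt0 ?exprn_gt0 // => h.
  by rewrite ler_pdivrMr ?exprn_gt0 //; lra.
(* Of the [5 * nu], two come from [exists_parameters], one from [s], and two are the reserve in
   [slack]. *)
pose kap := D ^+ 2 / 2 + 5 * nu.
have slack : sig0 ^+ 2 / 2 * (1 + 5 * e) + 6 * s * sig0 ^+ 2 / p0 ^+ 2 <= kap - 2 * nu.
  by rewrite /kap; lra.
have kap0 : 0 <= kap by rewrite /kap; have := sqr_ge0 D; lra.
(* The top atom then has mass [(1 + eta) / 2], strictly between [eta] and 1. *)
pose r := - ln ((1 + eta) / 2).
have eh0 : 0 < (1 + eta) / 2 by lra.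
have er : expR (- r) = (1 + eta) / 2 by rewrite /r opprK lnK.
have r0 : 0 < r by rewrite /r oppr_gt0; apply: ln_lt0; apply/andP; split; lra.
move: r er r0 => r er r0.
pose m := poisson_pmf r; pose th := grid_angle lo hi; pose x k := angle_mean (th k).
have m_gt0 k : 0 < m k by apply: poisson_pmf_gt0.
have th_bounds k : lo <= th k <= hi by apply: grid_angle_bounds.
have x0 : x 0%N = alpha by rewrite /x /th /grid_angle eqxx.
have x_le k : 0 <= x k <= x 0%N.
  have /andP[h1 h2] := th_bounds k; have /andP[h3 _] := mean_bounds _ (th_bounds k).
  rewrite (le_trans (ltW p00) h3) /= x0 -ma.
  exact: (angle_mean_le (le_trans (ltW lo0) h1) h2).
have x01 k : 0 <= x k <= 1.
  by have /andP[-> h] := x_le k; rewrite (le_trans h) // x0 ltW.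
exists (poisson_reservoir r x).
have res : is_reservoir (poisson_reservoir r x) by apply: poisson_reservoir_is_reservoir.
split => //; split.
  by rewrite -x0; apply: poisson_reservoir_Ginv => //; rewrite ?x0 ?er; lra.
move=> A hA.
have e2 : e <= 2^-1 by apply: le_trans e16 _; rewrite lef_pV2 ?posrE // ler_nat.
apply: le_trans (@poisson_limn_einf_le R lo hi p0 e s kap nu sig0 r beta (ltW lo0) lohi
  thapi p00 mean_bounds e0 e2 s0 sp nu0 nu1 (ltW sig00) sigE slack r0 x_lo_beta res
  (ltW p01) A hA) _.
by rewrite lee_fin cE /kap /nu; lra.
Qed.
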